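(* For every $\delta>0$ there exist a connected network $(V,c_0)$ with $\pi_0(v)<\infty$ for all $v\in V$, a vertex $v_0\in V$, a constant $\alpha\in(0,1)$, and a deterministic non-increasing sequence of conductances $(c_t)_{t\in\mathbb{N}}$ on $V$ (starting from $c_0$) with $c_t\downarrow c_\infty$ pointwise, where $c_\infty\ge\alpha c_0$, in which every edge changes its conductance at most once in time, such that every network $(V,c_t)$ for $t\in\mathbb{N}\cup\{\infty\}$ is recurrent, and yet the random walk $(X_t)_{t\ge0}$ in the changing environment $(c_t)_{t\ge0}$ with $X_0=v_0$ visits every vertex of $V$ only finitely often with probability at least $1-\delta$. In particular, it is false that whenever $c_t\downarrow c_\infty\ge\alpha c_0$ for some $\alpha>0$ and the random walk on $c_0$ is irreducible and recurrent, the walk $(X_t)_{t\ge0}$ must almost surely visit every vertex infinitely often.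
   Context: A network $(V,c)$ is a countable vertex set $V$ with symmetric conductances $c:V\times V\to[0,\infty)$; its edges are the pairs $e$ with $c(e)>0$. The total conductance of a vertex is $\pi(y)=\sum_z c(y,z)$ ($\pi_t$ denotes the one for $c_t$). The random walk on $(V,c)$ at $y$ jumps to $z$ with probability $c(y,z)/\pi(y)$; the network is called transient (recurrent) if this time-homogeneous walk is. The random walk in the changing environment $(c_t)_{t\ge0}$ is the time-inhomogeneous Markov chain with $\mathbb{P}(X_{t+1}=z\mid X_t=y)=c_t(y,z)/\pi_t(y)$. *)

(* Defs.v *)
From HB Require Import structures.
From mathcomp Require Export all_boot all_order all_algebra.
From mathcomp Require Export all_classical all_reals all_analysis.

Set Implicit Arguments.
Unset Strict Implicit.
Unset Printing Implicit Defensive.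
Import Order.TTheory GRing.Theory Num.Theory.
Import numFieldNormedType.Exports.
Local Open Scope classical_set_scope.
Local Open Scope ring_scope.

Definition network (R : realType) (V : countType) (c : V -> V -> R) : Prop :=
  (forall x y, 0 <= c x y) /\ (forall x y, c x y = c y x).

Definition connected_network (R : realType) (V : countType) (c : V -> V -> R)
    : Prop :=
  forall x y : V, exists2 p : seq V, path (fun u v => 0 < c u v) x p & last x p = y.

Definition total_conductance (R : realType) (V : countType) (c : V -> V -> R)
    (y : V) : \bar R :=
  \esum_(z in [set: V]) (c y z)%:E.

(* A junk value where the total conductance is 0 or +oo; [walk] below then has
   no inhabitant that reaches such a vertex with positive probability. *)
Definition transition (R : realType) (V : countType) (c : V -> V -> R)
    (y z : V) : R :=
  c y z / fine (total_conductance c y).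

(* Only meaningful when P B != 0. *)
Definition cond_prob d (T : measurableType d) (R : realType)
    (P : probability T R) (A B : set T) : R :=
  fine (P (A `&` B)) / fine (P B).

(* A realization, on some probability space, of the random walk in the changing
   environment c started at v0. The vertex set is discrete, so every set of
   vertices is an event. The conditioning is on the whole past, which expresses
   the Markov property together with the transition probabilities. *)
Record walk (R : realType) (V : countType) (c : nat -> V -> V -> R) (v0 : V) :=
  Walk {
    walk_disp : measure_display;
    walk_space : measurableType walk_disp;
    walk_P : probability walk_space R;
    walk_X : nat -> walk_space -> V;
    walk_measurable : forall t (A : set V), measurable (walk_X t @^-1` A);
    walk_start : walk_P (walk_X 0%N @^-1` [set v0]) = 1%E;
    walk_step : forall (t : nat) (x : nat -> V) (z : V),
      let past := [set w | forall s, (s <= t)%N -> walk_X s w = x s] in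
      walk_P past != 0%E ->
      cond_prob walk_P (walk_X t.+1 @^-1` [set z]) past
        = transition (c t) (x t) z }.

Arguments walk_X {R V c v0} _ _ _.

Definition walk_pr (R : realType) (V : countType) (c : nat -> V -> V -> R)
    (v0 : V) (X : walk c v0) (E : set (nat -> V)) : \bar R :=
  walk_P X [set w | E (fun t => walk_X X t w)].

(* All realizations have the same law, so a property of the law holds for "the"
   walk when it holds for all realizations; requiring one to exist keeps this
   from being vacuous when the transition probabilities are undefined. *)
Definition for_walk (R : realType) (V : countType) (c : nat -> V -> V -> R)
    (v0 : V) (Q : walk c v0 -> Prop) : Prop :=
  inhabited (walk c v0) /\ forall X : walk c v0, Q X.

Definition network_walk_irreducible (R : realType) (V : countType)
    (c : V -> V -> R) : Prop :=
  forall x y : V, for_walk (fun X : walk (fun=> c) x =>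
    exists n : nat, (0 < walk_pr X [set w | w n = y])%E).

Definition recurrent_network (R : realType) (V : countType)
    (c : V -> V -> R) : Prop :=
  forall x : V, for_walk (fun X : walk (fun=> c) x =>
    walk_pr X [set w | exists2 t : nat, (0 < t)%N & w t = x] = 1%E).

Definition decreases_to (R : realType) (V : countType)
    (c : nat -> V -> V -> R) (cinf : V -> V -> R) : Prop :=
  forall x y : V, nonincreasing_seq (fun t => c t x y) /\
    (fun t => c t x y) @ \oo --> cinf x y.

Definition changes_at_most_once (R : realType) (V : countType)
    (c : nat -> V -> V -> R) : Prop :=
  forall (x y : V) (s t : nat),
    c s.+1 x y != c s x y -> c t.+1 x y != c t x y -> s = t.

Definition finitely_often (V : countType) : set (nat -> V) :=
  [set w | forall v : V, finite_set [set t | w t = v]].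

Definition infinitely_often (V : countType) : set (nat -> V) :=
  [set w | forall v : V, infinite_set [set t | w t = v]].

(* Main.v *)
Require Import Defs.
From mathcomp Require Import ring lra zify measurable_realfun.
Import Order.TTheory GRing.Theory Num.Theory.
Import numFieldNormedType.Exports.
Local Open Scope classical_set_scope.
Local Open Scope ring_scope.
Set Implicit Arguments.
Unset Strict Implicit.
Unset Printing Implicit Defensive.

(** The network lives on the quadrant. Put [(k, j)] in layer [l = k + 2j], give
    it a weight decaying exponentially in [l], and join it, proportionally to
    weights, to [(k + 1, j)] and [(k - 1, j + 1)] in layer [l + 1]; a loop of
    relative conductance of order [lam ^ l] holds the walk for that long. The
    boundary of the finite set of layers up to [N] has vanishing conductance, so
    every such network is recurrent.

    At time [lam ^ (l + 1)] the conductances of the edges [(k, j) - (k + 1, j)]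
    leaving layer [l] drop by a constant factor, so that the front between
    dropped and undropped edges climbs one layer per epoch. A walk on the front
    layer has dropped edges behind it and an undropped edge towards [k + 1]
    ahead of it, hence mostly increases [k]. A walk that falls behind the front
    sees mainly the edges [(k, j) - (k - 1, j + 1)], along which the weight
    increases upwards: it climbs back to the front within an epoch, losing some
    [k] on the way. On balance [k] grows: [2^-k], multiplied by a factor that
    depends only on the time and the layer, is a supermartingale as long as it
    stays below 1. *)

(** * Locally finite networks *)

(** Finite lists turn total conductances and one-step expectations into finite sums. The list [nb x]
    has to contain every neighbour of [x] but may be longer. *)
Record locally_finite (R : realType) (V : countType) (c : V -> V -> R)
    (nb : V -> seq V) : Prop := LocallyFinite {
  lf_uniq : forall x, uniq (nb x);
  lf_ge0 : forall x y, 0 <= c x y;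
  lf_out : forall x y, y \notin nb x -> c x y = 0;
  lf_gt0 : forall x, 0 < \sum_(y <- nb x) c x y }.

Section LocallyFiniteTransitions.
Variables (R : realType) (V : countType) (c : V -> V -> R) (nb : V -> seq V).
Hypothesis cnb : locally_finite c nb.

Lemma total_conductanceE y :
  total_conductance c y = (\sum_(z <- nb y) c y z)%:E.
Proof.
rewrite /total_conductance (esumID [set` nb y]); last first.
  by move=> z _; rewrite lee_fin (lf_ge0 cnb).
rewrite setTI esum_fset; last 2 first.
- exact: finite_seq.
- by move=> z _; rewrite lee_fin (lf_ge0 cnb).
rewrite esum1 ?adde0; last first.
  by move=> z [_ /negP zy]; rewrite (lf_out cnb).
rewrite -fsbig_seq ?(lf_uniq cnb)//.
by rewrite sumEFin.
Qed.

Lemma transitionE y z :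
  transition c y z = c y z / \sum_(z <- nb y) c y z.
Proof. by rewrite /transition total_conductanceE. Qed.

Lemma transition_ge0 y z : 0 <= transition c y z.
Proof. by rewrite transitionE divr_ge0 ?(lf_ge0 cnb) ?ltW ?(lf_gt0 cnb). Qed.

Lemma transition_out y z : z \notin nb y -> transition c y z = 0.
Proof. by move=> zy; rewrite transitionE (lf_out cnb) ?mul0r. Qed.

Lemma sum_transition y : \sum_(z <- nb y) transition c y z = 1.
Proof.
under eq_bigr do rewrite transitionE.
by rewrite -mulr_suml divff// gt_eqF// (lf_gt0 cnb).
Qed.

Lemma transition_gt0 y z : 0 < c y z -> 0 < transition c y z.
Proof. by move=> h; rewrite transitionE divr_gt0// (lf_gt0 cnb). Qed.

Lemma sum_transition_mul y (f : V -> R) :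
  \sum_(z <- nb y) transition c y z * f z =
  (\sum_(z <- nb y) c y z * f z) / \sum_(z <- nb y) c y z.
Proof.
rewrite mulr_suml; apply: eq_bigr => z _; rewrite transitionE.
by rewrite mulrAC.
Qed.

End LocallyFiniteTransitions.

(** * One-step bounds for the probabilities of events *)

Section WalkBounds.
Variables (R : realType) (V : countType) (c : nat -> V -> V -> R) (v0 : V).
Variables (nb : V -> seq V).
Hypothesis cnb : forall t, locally_finite (c t) nb.
Variable X : walk c v0.

Let P := walk_P X.

Definition past (t : nat) (x : nat -> V) : set (walk_space X) :=
  [set w | forall s, (s <= t)%N -> walk_X X s w = x s].

Lemma pastS t x : past t.+1 x = past t x `&` walk_X X t.+1 @^-1` [set x t.+1].
Proof.
apply/seteqP; split => w /=.
  by move=> h; split => [s st|]; apply: h => //; exact: leqW.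
by move=> [h1 h2] s; rewrite leq_eqVlt => /predU1P[->//|]; exact: h1.
Qed.

Lemma past0 x : past 0 x = walk_X X 0 @^-1` [set x 0%N].
Proof.
apply/seteqP; split => w /=; first by apply.
by move=> h s; rewrite leqn0 => /eqP ->.
Qed.

Lemma measurable_past t x : measurable (past t x).
Proof.
elim: t => [|t ih]; first by rewrite past0; exact: walk_measurable.
by rewrite pastS; apply: measurableI => //; exact: walk_measurable.
Qed.

(** With the denominator cleared, the formula also covers a null past, where both sides vanish. *)
Lemma past_step t x z :
  P (past t x `&` walk_X X t.+1 @^-1` [set z]) =
  (P (past t x) * (transition (c t) (x t) z)%:E)%E.
Proof.
have mA := measurable_past t x.
have mB : measurable (walk_X X t.+1 @^-1` [set z]) by exact: walk_measurable.
have [p0|p0] := eqVneq (P (past t x)) 0%E.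
  rewrite p0 mul0e; apply/eqP; rewrite eq_le measure_ge0 andbT -p0.
  by rewrite measureIl.
have := walk_step z p0; rewrite /cond_prob -/(past t x) => <-.
rewrite setIC.
have fA : P (past t x) \is a fin_num by exact: fin_num_measure.
have fB : P (walk_X X t.+1 @^-1` [set z] `&` past t x) \is a fin_num.
  by apply: fin_num_measure; exact: measurableI.
rewrite -{1}(fineK fA) -EFinM mulrC divfK ?fineK//.
by rewrite fine_eq0.
Qed.

Lemma prob_mem_seq (A : set (walk_space X)) t (l : seq V) :
  measurable A -> uniq l ->
  P (A `&` walk_X X t @^-1` [set` l]) =
  (\sum_(z <- l) P (A `&` walk_X X t @^-1` [set z]))%E.
Proof.
move=> mA; elim: l => [_|y l ih /= /andP[yl ul]].
  rewrite big_nil (_ : _ `&` _ = set0) ?measure0//.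
  by apply/seteqP; split => w //= -[].
have mX B : measurable (walk_X X t @^-1` B) by exact: walk_measurable.
rewrite big_cons -ih//.
rewrite -measureU; [|exact: measurableI|exact: measurableI|].
- congr (P _); apply/seteqP; split => w /=.
    by rewrite inE => -[Aw /orP[/eqP|]]; [left|right].
  by rewrite inE => -[[Aw ->]|[Aw ->]]; rewrite ?eqxx ?orbT.
- apply/seteqP; split => w //= [[_ e] [_]].
  by rewrite e (negPf yl).
Qed.

Lemma past_neighbours t x (E : set (walk_space X)) : measurable E ->
  P (past t x `&` E) =
  (\sum_(z <- nb (x t)) P (past t x `&` walk_X X t.+1 @^-1` [set z] `&` E))%E.
Proof.
move=> mE; have mA := measurable_past t x.
have mX B : measurable (walk_X X t.+1 @^-1` B) by exact: walk_measurable.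
(* The transition probabilities over [nb (x t)] sum to 1, so the steps within the list already carry
   the full probability of the past. *)
have out0 : P (past t x `\` walk_X X t.+1 @^-1` [set` nb (x t)]) = 0%E.
  have fA B : measurable B -> P B \is a fin_num by exact: fin_num_measure.
  have e : P (past t x) =
      (P (past t x `\` walk_X X t.+1 @^-1` [set` nb (x t)]) +
       P (past t x `&` walk_X X t.+1 @^-1` [set` nb (x t)]))%E.
    exact: measureDI.
  rewrite prob_mem_seq ?(lf_uniq (cnb t))// in e.
  rewrite (eq_bigr (fun z => (fine (P (past t x)) *
      transition (c t) (x t) z)%:E)) in e; last first.
    by move=> z _; rewrite past_step [RHS]EFinM fineK// fA.
  rewrite sumEFin -mulr_sumr (sum_transition (cnb t)) mulr1 in e.
  rewrite (fineK (fA _ mA)) in e.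
  by rewrite -[LHS](addeK _ (fA _ mA)) -e subee ?fA.
pose B := walk_X X t.+1 @^-1` [set` nb (x t)].
have mpE : measurable (past t x `&` E) by exact: measurableI.
have -> : P (past t x `&` E) =
    (P ((past t x `&` E) `\` B) + P ((past t x `&` E) `&` B))%E.
  exact: (measureDI P mpE (mX _)).
have -> : P ((past t x `&` E) `\` B) = 0%E.
  apply/eqP; rewrite eq_le measure_ge0 andbT -out0 le_measure ?inE//.
  - exact: (measurableD mpE (mX _)).
  - exact: (measurableD mA (mX _)).
  - by move=> w [[? _] ?]; split.
rewrite add0e prob_mem_seq ?(lf_uniq (cnb t))//.
by apply: eq_bigr => z _; rewrite setIAC.
Qed.

(* [h n t x] dominates the probability of [E n t], an event about the [n] steps
   from time [t] on, given that the walk sits at [x] at time [t]. *)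
Lemma walk_bound (E : nat -> nat -> set (nat -> V)) (h : nat -> nat -> V -> R) :
  (forall n t, measurable [set w | E n t (fun s => walk_X X s w)]) ->
  (forall n t x, 0 <= h n t x) ->
  (forall n t x, [\/ 1 <= h n t x, (forall w, E n t w -> w t = x -> False) |
     exists m, [/\ n = m.+1,
       (forall w, E n t w -> w t = x -> E m t.+1 w) &
       \sum_(z <- nb x) transition (c t) x z * h m t.+1 z <= h n t x]]) ->
  forall n t x,
  (P (past t x `&` [set w | E n t (fun s => walk_X X s w)]) <=
   P (past t x) * (h n t (x t))%:E)%E.
Proof.
move=> mE h0 hE n; have mA := measurable_past.
elim/ltn_ind: n => n ih t x.
case: (hE n t (x t)) => [h1|F|[m [nm Em hm]]].
- apply: (@le_trans _ _ (P (past t x))); first by rewrite measureIl.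
  by rewrite -{1}[P _]mule1 lee_wpmul2l ?lee_fin.
- rewrite (_ : _ `&` _ = set0) ?measure0 ?mule_ge0 ?lee_fin//.
  by apply/seteqP; split => w //= [pw /F]; apply; exact: pw.
- apply: (@le_trans _ _ (P (past t x `&`
      [set w | E m t.+1 (fun s => walk_X X s w)]))).
    rewrite le_measure ?inE//; [exact: measurableI|exact: measurableI|].
    by move=> w [pw /= Ew]; split => //; apply: Em => //; exact: pw.
  rewrite past_neighbours//.
  apply: (@le_trans _ _ (\sum_(z <- nb (x t))
      P (past t x) * (transition (c t) (x t) z * h m t.+1 z)%:E)%E).
    apply: lee_sum => z _.
    (* Redirecting [x] to [z] after time [t] makes the event a [past] again, to which the induction
       hypothesis applies. *)
    pose x' s := if (s <= t)%N then x s else z.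
    have px' : past t x = past t x'.
      by apply/seteqP; split => w pw s st; have := pw s st; rewrite /x' st.
    have x't : x' t.+1 = z by rewrite /x' ltnn.
    have -> : past t x `&` walk_X X t.+1 @^-1` [set z] = past t.+1 x'.
      by rewrite pastS -px' x't.
    apply: (le_trans (ih m _ _ _)); first by rewrite nm.
    by rewrite x't pastS -px' x't past_step -muleA EFinM.
  rewrite -ge0_sume_distrr; last first.
    move=> z _; rewrite lee_fin mulr_ge0//; exact: (transition_ge0 (cnb t)).
  by rewrite sumEFin lee_wpmul2l ?lee_fin.
Qed.

End WalkBounds.

Arguments past {R V c v0} X t x.

Lemma countable_bigcap_measurable d (T : measurableType d) (V : countType)
    (F : V -> set T) :
  (forall v, measurable (F v)) -> measurable (\bigcap_(v in [set: V]) F v).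
Proof.
move=> mF; rewrite -[X in measurable X]setCK setC_bigcap.
apply: measurableC; apply: countable_bigcupT_measurable; first exact: countableP.
by move=> v; exact: measurableC.
Qed.

(** * Events about whole trajectories *)

Section WalkEvents.
Variables (R : realType) (V : countType) (c : nat -> V -> V -> R) (v0 : V).
Variables (nb : V -> seq V).
Hypothesis cnb : forall t, locally_finite (c t) nb.
Variable X : walk c v0.

Let P := walk_P X.

Lemma measurable_walk t (A : set V) : measurable [set w | A (walk_X X t w)].
Proof. exact: (walk_measurable X t A). Qed.

Lemma walk_bound0 (E : nat -> nat -> set (nat -> V)) (h : nat -> nat -> V -> R) :
  (forall n t, measurable [set w | E n t (fun s => walk_X X s w)]) ->
  (forall n t x, 0 <= h n t x) ->
  (forall n t x, [\/ 1 <= h n t x, (forall w, E n t w -> w t = x -> False) |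
     exists m, [/\ n = m.+1,
       (forall w, E n t w -> w t = x -> E m t.+1 w) &
       \sum_(z <- nb x) transition (c t) x z * h m t.+1 z <= h n t x]]) ->
  forall n, (P [set w | E n 0%N (fun s => walk_X X s w)] <= (h n 0%N v0)%:E)%E.
Proof.
move=> mE h0 hE n.
have := walk_bound cnb mE h0 hE n 0 (fun=> v0).
rewrite past0 walk_start mul1e; apply: le_trans.
set A := [set w | _]; set B := _ @^-1` _.
have mA : measurable A by exact: mE.
have mB : measurable B by exact: walk_measurable.
have -> : P A = (P (A `\` B) + P (A `&` B))%E by exact: measureDI.
have -> : P (A `\` B) = 0%E.
  apply/eqP; rewrite eq_le measure_ge0 andbT.
  have -> : 0%E = P (~` B).
    rewrite probability_setC// [X in (1 - X)%E](walk_start X : P B = 1%E).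
    by rewrite subee.
  by rewrite le_measure ?inE//; [exact: measurableD|exact: measurableC].
by rewrite add0e setIC.
Qed.

Lemma measurable_finitely_often :
  measurable [set w | @finitely_often V (fun t => walk_X X t w)].
Proof.
have -> : [set w | @finitely_often V (fun t => walk_X X t w)] =
    \bigcap_(v in [set: V]) \bigcup_N \bigcap_(t in [set t | (N <= t)%N])
      [set w | walk_X X t w != v].
  apply/seteqP; split => w /= h v.
    move=> _; have /finite_seqP[s hs] := h v.
    exists (\max_(i <- s) i.+1)%N => // t /= Nt; apply/eqP => tv.
    have ts : t \in s by have : [set` s] t by rewrite -hs.
    have := leq_trans (leq_bigmax_seq (F := succn) t ts isT) Nt.
    by rewrite ltnn.
  have [N _ hN] := h v I.
  apply: (@sub_finite_set _ _ `I_N); last exact: finite_II.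
  move=> t /= tv; rewrite ltnNge; apply/negP => Nt.
  by have /eqP := hN t Nt.
apply: countable_bigcap_measurable => v; apply: bigcup_measurable => N _.
apply: bigcap_measurableType => t _.
exact: (measurable_walk t (fun x => x != v)).
Qed.

Lemma measurable_infinitely_often :
  measurable [set w | @infinitely_often V (fun t => walk_X X t w)].
Proof.
have -> : [set w | @infinitely_often V (fun t => walk_X X t w)] =
    \bigcap_(v in [set: V]) \bigcap_N \bigcup_(t in [set t | (N <= t)%N])
      [set w | walk_X X t w = v].
  apply/seteqP; split => w /= h v.
    move=> _ N _; apply: contrapT => hN; apply: (h v).
    apply: (@sub_finite_set _ _ `I_N); last exact: finite_II.
    move=> t /= tv; rewrite ltnNge; apply/negP => Nt.
    by apply: hN; exists t.
  move=> /finite_seqP[s hs].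
  have [t /= Nt tv] := h v I (\max_(i <- s) i.+1)%N I.
  have ts : t \in s by have : [set` s] t by rewrite -hs.
  have := leq_trans (leq_bigmax_seq (F := succn) t ts isT) Nt.
  by rewrite ltnn.
apply: countable_bigcap_measurable => v; apply: bigcap_measurableType => N _.
apply: bigcup_measurable => t _.
exact: (measurable_walk t (fun x => x = v)).
Qed.

(* Optional stopping for the supermartingale [phi t (X_t)], run until it first
   reaches [1]. *)
Lemma walk_finitely_often (phi : nat -> V -> R) :
  (forall t x, 0 <= phi t x) ->
  (forall t x, phi t x < 1 ->
     \sum_(z <- nb x) transition (c t) x z * phi t.+1 z <= phi t x) ->
  (forall v, exists N, forall t, (N <= t)%N -> 1 <= phi t v) ->
  ((1 - phi 0%N v0)%:E <= walk_pr X (@finitely_often V))%E.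
Proof.
move=> phi0 phiS phi1.
pose E n t : set (nat -> V) :=
  [set w | exists2 s, (t <= s <= t + n)%N & 1 <= phi s (w s)].
have mE n t : measurable [set w | E n t (fun s => walk_X X s w)].
  have -> : [set w | E n t (fun s => walk_X X s w)] =
      \bigcup_(s in [set s | (t <= s <= t + n)%N])
        [set w | 1 <= phi s (walk_X X s w)].
    by apply/seteqP; split => w /= -[s st h]; exists s.
  apply: bigcup_measurable => s _.
  exact: (measurable_walk s (fun x => 1 <= phi s x)).
have bound n : (P [set w | E n 0%N (fun s => walk_X X s w)] <=
    (phi 0%N v0)%:E)%E.
  apply: (walk_bound0 mE (h := fun=> phi)) => // {}n t x.
  have [h|h] := leP 1 (phi t x); first by constructor 1.
  case: n => [|n]; [constructor 2|constructor 3].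
    move=> w [s]; rewrite addn0 -eqn_leq => /eqP <- + wt.
    by rewrite wt leNgt h.
  exists n; split => //; last exact: phiS.
  move=> w [s /andP[ts sn] hs wt]; exists s => //.
  rewrite addSnnS sn andbT ltn_neqAle ts andbT.
  by apply/eqP => e; move: hs; rewrite -e wt leNgt h.
(* The bound is uniform in [n], so it passes to the increasing union: the event that [phi] ever
   reaches 1. *)
pose U := \bigcup_n [set w | E n 0%N (fun s => walk_X X s w)].
have mU : measurable U by exact: bigcup_measurable.
have ndE : nondecreasing_seq (fun n => [set w | E n 0%N (fun s => walk_X X s w)]).
  move=> m n mn; apply/subsetPset => w [s /andP[s0 sm] hs].
  by exists s => //; rewrite s0 (leq_trans sm)// leq_add2l.
have PU : (P U <= (phi 0%N v0)%:E)%E.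
  have cvgU := nondecreasing_cvg_mu (mu := P) (fun n => mE n 0%N) mU ndE.
  rewrite -(cvg_lim _ cvgU)//; apply: lime_le; last exact: nearW.
  by apply/cvg_ex; eexists; exact: cvgU.
apply: (@le_trans _ _ (P (~` U))).
  by rewrite probability_setC// EFinB leeB.
rewrite /walk_pr le_measure ?inE//.
- exact: measurableC.
- exact: measurable_finitely_often.
move=> w /= Uw v.
(* Off [U] the value of [phi] stays below 1 forever, whereas a visit to [v] from time [N] on would
   make it at least 1. *)
have [N hN] := phi1 v.
apply: (@sub_finite_set _ _ `I_N); last exact: finite_II.
move=> t /= tv; rewrite ltnNge; apply/negP => Nt; apply: Uw.
by exists t => //; exists t; rewrite ?add0n ?leqnn//= tv; exact: hN.
Qed.

Lemma walk_not_infinitely_often :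
  (0 < walk_pr X (@finitely_often V))%E ->
  walk_pr X (@infinitely_often V) <> 1%E.
Proof.
move=> fin0 inf1.
have mF := measurable_finitely_often; have mI := measurable_infinitely_often.
have : (walk_pr X (@finitely_often V) <=
    P (~` [set w | @infinitely_often V (fun t => walk_X X t w)]))%E.
  rewrite /walk_pr le_measure ?inE//; first exact: measurableC.
  by move=> w /= fw iw; exact: (iw v0 (fw v0)).
rewrite probability_setC//.
rewrite [X in (1 - X)%E](inf1 : P _ = _) subee//.
by rewrite leNgt fin0.
Qed.

(** The event of following [p] step by step has a product of positive transition probabilities as
    its probability. *)
Lemma walk_reach (y : V) (p : seq V) :
  (forall t x z, 0 < c 0%N x z -> 0 < c t x z) ->
  path (fun u v => 0 < c 0%N u v) v0 p ->
  (0 < walk_pr X [set w | w (size p) = last v0 p])%E.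
Proof.
move=> cpos pp.
pose x t := nth v0 (v0 :: p) t.
have pos t : (t <= size p)%N -> (0 < P (past X t x))%E.
  elim: t => [_|t ih tp].
    rewrite past0 /x /= walk_start//.
  rewrite pastS past_step mule_gt0 ?ih ?(ltnW tp)// lte_fin.
  apply: (transition_gt0 (cnb t)); apply: cpos.
  by have /(pathP v0)/(_ _ tp) := pp.
apply: lt_le_trans (pos _ (leqnn _)) _.
rewrite le_measure ?inE//; first exact: measurable_past.
  exact: (measurable_walk _ (fun x => x = _)).
by move=> w /= /(_ _ (leqnn _)) ->; rewrite /x nth_last.
Qed.

End WalkEvents.

(** * Recurrence from small boundaries *)

Section Recurrence.
Variables (R : realType) (V : countType) (c : V -> V -> R) (nb : V -> seq V).
Hypothesis cnb : locally_finite c nb.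
Hypothesis csym : forall x y, c x y = c y x.

Let conductance x := \sum_(y <- nb x) c x y.

Section Avoid.
Variable o : V.

(* Probability that the walk from [x] is not at [o] at any of the times
   [0, ..., n]. *)
Fixpoint avoid (n : nat) (x : V) : R :=
  if x == o then 0
  else if n is m.+1 then \sum_(z <- nb x) transition c x z * avoid m z else 1.

(** One step is made before [avoid] starts counting, so this concerns the times [1, ..., n + 1]. *)
Definition no_return (n : nat) : R :=
  \sum_(z <- nb o) transition c o z * avoid n z.

Lemma avoid0 x : avoid 0 x = if x == o then 0 else 1.
Proof. by []. Qed.

Lemma avoidS n x : avoid n.+1 x =
  if x == o then 0 else \sum_(z <- nb x) transition c x z * avoid n z.
Proof. by []. Qed.

Lemma avoid_ge0 n x : 0 <= avoid n x.
Proof.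
elim: n x => [|n ih] x /=; case: ifP => // _.
by apply: sumr_ge0 => z _; rewrite mulr_ge0// (transition_ge0 cnb).
Qed.

Lemma avoid_target n : avoid n o = 0.
Proof. by case: n => [|n] /=; rewrite eqxx. Qed.

Lemma avoid_le1 n x : avoid n x <= 1.
Proof.
elim: n x => [|n ih] x /=; case: ifP => // _.
rewrite -(sum_transition cnb x); apply: ler_sum => z _.
by rewrite ler_piMr// (transition_ge0 cnb).
Qed.

Lemma avoid_nonincreasing n x : avoid n.+1 x <= avoid n x.
Proof.
elim: n x => [|n ih] x.
  have [->|xo] := eqVneq x o; first by rewrite !avoid_target.
  by rewrite [leRHS]/= (negPf xo) avoid_le1.
rewrite !avoidS; case: ifP => // _.
by apply: ler_sum => z _; rewrite ler_wpM2l// ?(transition_ge0 cnb).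
Qed.

Lemma no_return_nonincreasing m n : (m <= n)%N -> no_return n <= no_return m.
Proof.
move=> mn; rewrite -(subnK mn); elim: (n - m)%N => [//|k ih].
apply: le_trans ih; rewrite addSn; apply: ler_sum => z _.
by rewrite ler_wpM2l ?(transition_ge0 cnb)// avoid_nonincreasing.
Qed.

End Avoid.

Arguments avoid : simpl never.

(** Between two vertices of [B] the summand is antisymmetric and cancels. On a boundary edge the
    difference [a y - a x] is at most 1, which leaves the conductance. *)
Lemma flow_out_le (B : seq V) (a : V -> R) : uniq B ->
  (forall x, 0 <= a x <= 1) ->
  \sum_(x <- B) \sum_(y <- nb x) c x y * (a y - a x) <=
  \sum_(x <- B) \sum_(y <- nb x | y \notin B) c x y.
Proof.
move=> uB a01.
have inner0 : \sum_(x <- B) \sum_(y <- nb x | y \in B) c x y * (a y - a x) = 0.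
  have e x : \sum_(y <- nb x | y \in B) c x y * (a y - a x) =
      \sum_(y <- B) c x y * (a y - a x).
    transitivity (\sum_(y <- B | y \in nb x) c x y * (a y - a x)).
      rewrite -big_filter -[RHS]big_filter; apply: perm_big.
      apply: uniq_perm; rewrite ?filter_uniq ?(lf_uniq cnb)// => y.
      by rewrite !mem_filter andbC.
    rewrite big_mkcond; apply: eq_bigr => y _; case: ifPn => // /(lf_out cnb) ->.
    by rewrite mul0r.
  under eq_bigr do rewrite e.
  set S := (X in X = 0); have : S = - S.
    rewrite {1}/S exchange_big /= -sumrN; apply: eq_bigr => x _.
    rewrite -sumrN; apply: eq_bigr => y _.
    by rewrite csym -mulrN opprB.
  by lra.
rewrite (eq_bigr (fun x => \sum_(y <- nb x | y \in B) c x y * (a y - a x) +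
    \sum_(y <- nb x | y \notin B) c x y * (a y - a x))); last first.
  by move=> x _; rewrite (bigID (mem B)).
rewrite big_split /= inner0 add0r; apply: ler_sum => x _; apply: ler_sum => y _.
rewrite ler_piMr ?(lf_ge0 cnb)//.
by have := a01 x; have := a01 y; lra.
Qed.

(* The flow [c x y * (a y - a x)] of [a = avoid o n] out of [B] bounds the flow
   entering at [o], up to a discrepancy that telescopes over [n]. *)
Lemma no_return_le (o : V) (B : seq V) (M : nat) : uniq B -> o \in B ->
  M%:R * (conductance o * no_return o M) <=
  M%:R * (\sum_(x <- B) \sum_(y <- nb x | y \notin B) c x y) +
  \sum_(x <- B) conductance x.
Proof.
move=> uB oB; set C := \sum_(x <- B) \sum_(y <- nb x | y \notin B) c x y.
have pi_gt0 x : 0 < conductance x by exact: lf_gt0 cnb x.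
pose S n := \sum_(x <- B) conductance x * avoid o n x.
have step n : conductance o * no_return o n <= C + (S n - S n.+1).
  have := flow_out_le uB (a := avoid o n) _.
  have h x : 0 <= avoid o n x <= 1 by rewrite avoid_ge0 avoid_le1.
  move=> /(_ h); rewrite -/C.
  (* At [x] other than [o], the inner sum is [conductance x] times the change of [avoid] from [n] to
     [n + 1]. At [o], where [avoid] vanishes, it is the flow of the walks that do not return. *)
  have -> : \sum_(x <- B) \sum_(y <- nb x) c x y * (avoid o n y - avoid o n x) =
      conductance o * no_return o n + (S n.+1 - S n).
    rewrite /S -sumrB !(bigD1_seq o oB uB) /=.
    rewrite !avoid_target mulr0 subrr add0r; congr (_ + _).
      rewrite /no_return (sum_transition_mul cnb) mulrC divfK ?gt_eqF ?pi_gt0//.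
      by apply: eq_bigr => y _; rewrite subr0.
    apply: eq_bigr => x xo; rewrite avoidS (negPf xo).
    rewrite (sum_transition_mul cnb) [X in X - _]mulrC divfK ?gt_eqF ?pi_gt0//.
    rewrite /conductance mulr_suml -sumrB.
    by apply: eq_bigr => y _; rewrite mulrBr.
  lra.
have S0 n : 0 <= S n.
  by apply: sumr_ge0 => x _; rewrite mulr_ge0 ?avoid_ge0 ?ltW.
have S1 : S 0%N <= \sum_(x <- B) conductance x.
  by apply: ler_sum => x _; rewrite ler_piMr ?avoid_le1 ?ltW.
(* The one-step bounds are summed with [no_return o M] in place of each [no_return o N], which it
   does not exceed. *)
have sum N : (N <= M)%N ->
    N%:R * (conductance o * no_return o M) <= N%:R * C + (S 0%N - S N).
  elim: N => [_|N ih NM]; first by rewrite !mul0r subrr addr0.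
  have := ih (ltnW NM); have := step N.
  have : conductance o * no_return o M <= conductance o * no_return o N.
    by apply: ler_wpM2l; [exact/ltW/pi_gt0|exact/no_return_nonincreasing/ltnW].
  by rewrite -natr1; lra.
by have := sum M (leqnn _); have := S0 M; lra.
Qed.

(** Such finite sets separate [o] from infinity by arbitrarily small conductance, which is a
    classical criterion for recurrence. *)
Definition small_boundaries : Prop :=
  forall (o : V) (e : R), 0 < e -> exists B : seq V, [/\ uniq B, o \in B &
    \sum_(x <- B) \sum_(y <- nb x | y \notin B) c x y <= e].

Lemma no_return_small (o : V) (e : R) : small_boundaries -> 0 < e ->
  exists M, no_return o M <= e.
Proof.
move=> small e0; have po : 0 < conductance o by exact: lf_gt0 cnb o.
have [|B [uB oB Be]] := small o (conductance o * e / 2).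
  by rewrite divr_gt0// mulr_gt0.
set S := \sum_(x <- B) conductance x.
have S0 : 0 <= S by apply: sumr_ge0 => x _; rewrite ltW// (lf_gt0 cnb).
(* Half of [e] is spent on the boundary of [B]; [M] is large enough for the total conductance of
   [B], divided by [M], to fit into the other half. *)
pose M := (Num.truncn (S / (conductance o * e / 2))).+1.
exists M.
have d0 : 0 < conductance o * e / 2 by rewrite divr_gt0// mulr_gt0.
have MS : S <= M%:R * (conductance o * e / 2).
  by rewrite -ler_pdivrMr// ltW// truncnS_gt.
have M0 : 0 < M%:R :> R by rewrite ltr0n.
have := no_return_le M uB oB; rewrite -/S.
set C := \sum_(x <- B) _ in Be *.
move=> h; rewrite -(ler_pM2l po) -(ler_pM2l M0).
have : M%:R * C <= M%:R * (conductance o * e / 2) by rewrite ler_pM2l.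
lra.
Qed.

Lemma walk_returns (o : V) (X : walk (fun=> c) o) : small_boundaries ->
  walk_pr X [set w | exists2 t : nat, (0 < t)%N & w t = o] = 1%E.
Proof.
move=> small.
pose E n t : set (nat -> V) :=
  [set w | forall s, (t <= s <= t + n)%N -> (0 < s)%N -> w s != o].
have mE n t : measurable [set w | E n t (fun s => walk_X X s w)].
  have -> : [set w | E n t (fun s => walk_X X s w)] =
      \bigcap_(s in [set s | (t <= s <= t + n)%N && (0 < s)%N])
        [set w | walk_X X s w != o].
    apply/seteqP; split => w /= h s.
      by move=> /andP[]; exact: h.
    by move=> h1 h2; apply: (h s); apply/andP.
  apply: bigcap_measurableType => s _.
  exact: (measurable_walk X s (fun x => x != o)).
(* Being at [o] at time 0 is not a return, so the first step is made unconditionally and [avoid]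
   enters only from time 1 on. *)
pose h n t x := if (0 < t)%N then avoid o n x else
  if n is m.+1 then \sum_(z <- nb x) transition c x z * avoid o m z else 1.
have h0 n t x : 0 <= h n t x.
  rewrite /h; case: ifP => _; first exact: avoid_ge0.
  case: n => // n; apply: sumr_ge0 => z _.
  by rewrite mulr_ge0 ?avoid_ge0// (transition_ge0 cnb).
have hE n t x : [\/ 1 <= h n t x, (forall w, E n t w -> w t = x -> False) |
     exists m, [/\ n = m.+1,
       (forall w, E n t w -> w t = x -> E m t.+1 w) &
       \sum_(z <- nb x) transition c x z * h m t.+1 z <= h n t x]].
  have ES m w : E m.+1 t w -> E m t.+1 w.
    by move=> Ew s /andP[ts sn]; apply: Ew; rewrite ltnW//= -addSnnS.
  case: n => [|n].
    rewrite /h; case: ifPn => t0 /=; last by constructor 1.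
    rewrite avoid0; case: ifPn => [/eqP xo|_]; last by constructor 1.
    constructor 2 => w Ew wt.
    by move: (Ew t); rewrite leqnn leq_addr t0 wt xo eqxx => /(_ isT isT).
  rewrite /h; case: ifPn => t0 /=.
    rewrite avoidS; case: ifPn => [/eqP xo|xo].
      constructor 2 => w Ew wt.
      by move: (Ew t); rewrite leqnn leq_addr t0 wt xo eqxx => /(_ isT isT).
    by constructor 3; exists n; split => // w /ES.
  by constructor 3; exists n; split => // w /ES.
have bound n := walk_bound0 (fun=> cnb) mE h0 hE n.
set A := [set w | _]; rewrite /walk_pr.
set B := [set w | _].
have BE : ~` B = \bigcap_n [set w | E n 0%N (fun s => walk_X X s w)].
  apply/seteqP; split => w /=.
    move=> Bw n _ s _ s0; apply/eqP => ws; apply: Bw; by exists s.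
  move=> Ew [s s0 ws].
  by have := Ew s I s; rewrite leqnn /= ws eqxx => /(_ isT s0).
have mB : measurable B.
  rewrite -[B]setCK BE; apply: measurableC.
  by apply: bigcapT_measurable => n; exact: mE.
have PB0 : walk_P X (~` B) = 0%E.
  apply/eqP; rewrite eq_le measure_ge0 andbT; apply/lee_addgt0Pr => e e0.
  rewrite add0e; have [M hM] := no_return_small o small e0.
  apply: (@le_trans _ _ (h M.+1 0%N o)%:E); last by rewrite lee_fin.
  apply: le_trans (bound M.+1); rewrite le_measure ?inE//.
    exact: measurableC.
  by rewrite BE => w Ew; exact: Ew.
have := probability_setC (walk_P X) mB; rewrite PB0 => e.
have fB : walk_P X B \is a fin_num by exact: fin_num_measure.
by rewrite -[LHS]add0e e subeK.
Qed.

End Recurrence.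

(** * Existence of walks *)

Section Pick.
Variables (R : realType) (V : countType) (p : V -> R) (x0 : V).
Hypothesis p_ge0 : forall x, 0 <= p x.

(* Inverts the cumulative distribution of the weights [p] on the list [l]: if
   [u] is uniform on [0, 1), the first component has law [p], and given it the
   second is again uniform on [0, 1). *)
Fixpoint pick (l : seq V) (u : R) : V * R :=
  if l is z :: l' then
    if u < p z then (z, u / p z) else pick l' (u - p z)
  else (x0, u).

Lemma pick_mem l u : u < \sum_(z <- l) p z -> 0 <= u -> (pick l u).1 \in l.
Proof.
elim: l u => [|y l ih] u /=; first by rewrite big_nil; lra.
rewrite big_cons inE => ul u0; case: ifPn => [_|]; first by rewrite eqxx.
by rewrite -leNgt => yu; rewrite ih ?orbT//; lra.
Qed.

(** The number [F] is the sum of the weights that precede [z] in [l]. *)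
Lemma pick_interval l z : uniq l -> z \in l ->
  exists F, [/\ 0 <= F, F + p z <= \sum_(y <- l) p y &
    forall u, 0 <= u < \sum_(y <- l) p y ->
      ((pick l u).1 == z) = (F <= u < F + p z) /\
      (F <= u < F + p z -> (pick l u).2 = (u - F) / p z)].
Proof.
elim: l => [//|y l ih] /= /andP[yl ul]; rewrite inE big_cons.
have sum0 : 0 <= \sum_(y <- l) p y by exact: sumr_ge0.
have [zy _|zy /= zl] := eqVneq z y.
  rewrite zy; exists 0; split; [by []|lra|] => u /andP[u0 us].
  rewrite u0 add0r subr0 /=.
  case: ifPn => [_|]; first by rewrite eqxx.
  rewrite -leNgt => yu; split => //; apply/eqP => e.
  by move: yl; rewrite -e pick_mem//; lra.
have [F [F0 Fs h]] := ih ul zl.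
exists (p y + F); split; [by rewrite addr_ge0|lra|] => u /andP[u0 us].
case: ifPn => [uy|]; last rewrite -leNgt => yu.
  rewrite /= eq_sym (negPf zy); split; last by lra.
  by apply/esym/negbTE; apply/negP => /andP[? ?]; lra.
have [|-> e] := h (u - p y); first by apply/andP; split; lra.
have -> : (F <= u - p y < F + p z) = (p y + F <= u < p y + F + p z).
  by apply/idP/idP => /andP[? ?]; apply/andP; split; lra.
split => // /andP[? ?]; rewrite e; last by apply/andP; split; lra.
by congr (_ / _); lra.
Qed.

Lemma measurable_pick l (z : V) (C : set R) : measurable C ->
  measurable [set u | (pick l u).1 = z /\ C (pick l u).2].
Proof.
move=> mC; elim: l => [|y l ih] /=.
  have [->|zx] := eqVneq z x0.
    rewrite (_ : [set _ | _] = C)//.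
    by apply/seteqP; split => u //= -[].
  rewrite (_ : [set _ | _] = set0)//.
  by apply/seteqP; split => u //= -[e]; rewrite e eqxx in zx.
have mpre (f : R -> R) (D : set R) : measurable_fun [set: R] f ->
    measurable D -> measurable (f @^-1` D).
  by move=> mf mD; rewrite -[X in measurable X]setTI; exact: mf.
have -> : [set u | (if u < p y then (y, u / p y) else pick l (u - p y)).1 = z /\
    C (if u < p y then (y, u / p y) else pick l (u - p y)).2] =
  (`]-oo, p y[ `&` [set u | y = z /\ C (u / p y)]) `|`
  (`[p y, +oo[ `&` (fun u => u - p y) @^-1`
     [set u | (pick l u).1 = z /\ C (pick l u).2]).
  apply/seteqP; split => u /=; rewrite !in_itv /= andbT.
    by case: ltP => uy /= h; [left|right].
  by case: ltP => uy [[]|[]].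
apply: measurableU; apply: measurableI => //.
  have [->|yz] := eqVneq y z.
    rewrite (_ : [set _ | _] = (fun u => u / p z) @^-1` C); last first.
      by apply/seteqP; split => u //= -[].
    by apply: mpre => //; exact: mulrr_measurable.
  rewrite (_ : [set _ | _] = set0)//.
  by apply/seteqP; split => u //= -[e]; rewrite e eqxx in yz.
apply: mpre => //; exact: measurable_funB.
Qed.

End Pick.

Lemma uniform_prob_itv (R : realType) (a b : R) : 0 <= a -> a <= b -> b <= 1 ->
  uniform_prob (@ltr01 R) `[a, b[ = (b - a)%:E.
Proof.
move=> a0 ab b1; rewrite /uniform_prob integral_uniform_pdf setIidl; last first.
  by move=> x /=; rewrite !in_itv /= => /andP[? ?]; apply/andP; split; lra.
rewrite (eq_integral (cst 1%E)); last first.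
  move=> x; rewrite inE /= in_itv /= => /andP[? ?].
  rewrite /uniform_pdf ifT; first by rewrite subr0 invr1.
  by apply/andP; split; lra.
rewrite integral_cst//= mul1e lebesgue_measure_itv/= lte_fin EFinB.
case: ltP => // ba; have -> : a = b by lra.
by rewrite subee.
Qed.

Section WalkExistence.
Variables (R : realType) (V : countType) (c : nat -> V -> V -> R) (v0 : V).
Variables (nb : V -> seq V).
Hypothesis cnb : forall t, locally_finite (c t) nb.

(** One uniform number drives the whole walk: after each choice the rescaled second component
    supplies the randomness for the next one. *)
Fixpoint state (t : nat) (u : R) : V * R :=
  if t is s.+1 then
    pick (transition (c s) (state s u).1) (state s u).1 (nb (state s u).1)
      (state s u).2
  else (v0, u).

Lemma measurable_state t z (C : set R) : measurable C ->
  measurable [set u | (state t u).1 = z /\ C (state t u).2].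
Proof.
elim: t z C => [|t ih] z C mC /=.
  have [->|zv] := eqVneq z v0.
    rewrite (_ : [set _ | _] = C)//.
    by apply/seteqP; split => u //= -[].
  rewrite (_ : [set _ | _] = set0)//.
  by apply/seteqP; split => u //= -[e]; rewrite e eqxx in zv.
(* For a fixed position [x] at time [t] the next pick uses fixed weights, and there are only
   countably many positions. *)
pose D x := [set y | (pick (transition (c t) x) x (nb x) y).1 = z /\
   C (pick (transition (c t) x) x (nb x) y).2].
rewrite (_ : [set _ | _] =
    \bigcup_x [set u | (state t u).1 = x /\ D x (state t u).2]); last first.
  apply/seteqP; split => u /=; first by move=> h; exists (state t u).1.
  by move=> [x _ /= [<-]].
apply: countable_bigcupT_measurable; first exact: countableP.
by move=> x; apply: ih; exact: measurable_pick.
Qed.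

Lemma measurable_state1 t (A : set V) : measurable [set u | A (state t u).1].
Proof.
rewrite (_ : [set _ | _] = \bigcup_z [set u | (state t u).1 = z /\
    [set _ | A z] (state t u).2]); last first.
  apply/seteqP; split => u /=; first by move=> h; exists (state t u).1.
  by move=> [x _ /= [<-]].
apply: countable_bigcupT_measurable; first exact: countableP.
move=> x; apply: measurable_state.
have [Ax|Ax] := pselect (A x).
  by rewrite (_ : [set _ | _] = setT)//; apply/seteqP; split.
by rewrite (_ : [set _ | _] = set0)//; apply/seteqP; split.
Qed.

(* The starting points [u] whose trajectory follows [x] up to time [t] form the
   interval [a, a + l), which the second component of the state rescales to
   [0, 1). *)
Definition path_interval (t : nat) (x : nat -> V) (a l : R) : Prop :=
  [/\ 0 <= a, 0 <= l, a + l <= 1 &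
   forall u, 0 <= u < 1 ->
     ((forall s, (s <= t)%N -> (state s u).1 = x s) <-> a <= u < a + l) /\
     (a <= u < a + l -> (state t u).2 = (u - a) / l)].

(** Picking [z] selects a subinterval of [0, 1) of length [transition (c t) (x t) z]; undoing the
    rescaling places it inside [a, a + l). *)
Lemma path_interval_step t x a l z : path_interval t x a l ->
  exists a', path_interval t.+1
     (fun s => if (s <= t)%N then x s else z) a' (l * transition (c t) (x t) z).
Proof.
move=> [a0 l0 al hal]; set p := transition (c t) (x t).
have p0 y : 0 <= p y by exact: transition_ge0 (cnb t) _ _.
have p1 : \sum_(y <- nb (x t)) p y = 1 by exact: sum_transition (cnb t) _.
have split_last u :
    (forall s, (s <= t.+1)%N -> (state s u).1 = if (s <= t)%N then x s else z)
    <-> (forall s, (s <= t)%N -> (state s u).1 = x s) /\ (state t.+1 u).1 = z.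
  split=> [h|[h1 h2] s].
    split=> [s st|]; first by rewrite h ?st// leqW.
    by rewrite h// ltnn.
  by rewrite leq_eqVlt => /predU1P[->|st]; rewrite ?ltnn// -ltnS st; exact: h1.
have at_x u : a <= u < a + l -> (state t u).1 = x t /\ 0 <= (state t u).2 < 1.
  move=> /andP[au ul]; have u01 : 0 <= u < 1 by apply/andP; split; lra.
  have [h1 h2] := hal _ u01; have h : a <= u < a + l by rewrite au ul.
  split; first exact: (h1.2 h).
  rewrite h2// ler_pdivlMr ?ltr_pdivrMr; lra.
have stateS u : a <= u < a + l ->
    state t.+1 u = pick p (x t) (nb (x t)) ((u - a) / l).
  move=> h; have [e _] := at_x _ h; move: (h) => /andP[au ul].
  have u01 : 0 <= u < 1 by apply/andP; split; lra.
  have [_ /(_ h) <-] := hal _ u01.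
  by rewrite /= e.
have [zn|zn] := boolP (z \in nb (x t)); last first.
  (* A vertex off the list is never picked, so the new interval is empty. *)
  exists a; rewrite (transition_out (cnb t) zn : p z = 0) mulr0.
  split; [lra|lra|lra|].
  move=> u u01; split; last by lra.
  split; last by lra.
  move=> /split_last[h1 h2]; have [h _] := hal _ u01.
  have hu := h.1 h1; exfalso; move/negP : zn; apply.
  have [_] := at_x _ hu; have [_ /(_ hu) ->] := hal _ u01.
  move=> /andP[y0 y1]; rewrite -h2 stateS// pick_mem//.
  by rewrite p1.
have [F [F0 Fp hF]] := pick_interval (x t) p0 (lf_uniq (cnb t) (x t)) zn.
rewrite p1 in Fp hF.
have lFp : l * F + l * p z <= l.
  by rewrite -mulrDr ler_piMr.
have lF : 0 <= l * F by rewrite mulr_ge0.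
have lp : 0 <= l * p z by rewrite mulr_ge0.
exists (a + l * F); split; [lra|lra|lra|].
move=> u u01; have [h1 h2] := hal _ u01.
have conv : a <= u < a + l ->
    (F <= (u - a) / l < F + p z) = (a + l * F <= u < a + l * F + l * p z).
  move=> /andP[au ul]; have l_gt0 : 0 < l by lra.
  rewrite ler_pdivlMr// ltr_pdivrMr//.
  by apply/idP/idP => /andP[? ?]; apply/andP; split; lra.
have y01 : a <= u < a + l -> 0 <= (u - a) / l < 1.
  by move=> h; have [_] := at_x _ h; rewrite h2.
split.
  rewrite split_last; split.
    move=> [/h1.1 hu]; rewrite stateS// => /eqP.
    by have [-> _] := hF _ (y01 hu); rewrite conv.
  move=> /andP[au ul].
  have hu : a <= u < a + l by apply/andP; split; lra.
  split; first exact: h1.2.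
  rewrite stateS//; apply/eqP; have [-> _] := hF _ (y01 hu).
  by rewrite conv// au ul.
move=> /andP[au ul]; have hu : a <= u < a + l by apply/andP; split; lra.
rewrite stateS//; have [_ ->] := hF _ (y01 hu); last by rewrite conv// au ul.
have l_gt0 : 0 < l by lra.
have p_gt0 : 0 < p z by rewrite -(pmulr_rgt0 _ l_gt0); lra.
by rewrite -/p; field; rewrite !gt_eqF.
Qed.

Lemma path_interval_exists t x : x 0%N = v0 ->
  exists a l, path_interval t x a l.
Proof.
move=> x0; elim: t => [|t [a [l h]]].
  exists 0, 1; split=> //; rewrite ?add0r// => u /andP[u0 u1].
  rewrite u0 u1 subr0 divr1; split=> //; split => // _ s.
  by rewrite leqn0 => /eqP ->.
have [a' [? ? ? h']] := path_interval_step (x t.+1) h.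
exists a', (l * transition (c t) (x t) (x t.+1)); split => // u u01.
have [h1 h2] := h' _ u01; split => //; rewrite -h1.
have e s : (s <= t.+1)%N -> (if (s <= t)%N then x s else x t.+1) = x s.
  by rewrite leq_eqVlt => /predU1P[->|]; rewrite ?ltnn// ltnS => ->.
by split=> hs s st; rewrite hs// e.
Qed.

Let P : probability (measurableTypeR R) R := uniform_prob (@ltr01 R).

Lemma prob_path t x a l : path_interval t x a l ->
  P [set u | forall s, (s <= t)%N -> (state s u).1 = x s] = l%:E.
Proof.
move=> [a0 l0 al h]; set A := [set u | _].
have mA : measurable A.
  rewrite (_ : A = \bigcap_(s in [set s | (s <= t)%N])
    [set u | (state s u).1 = x s])//.
  apply: bigcap_measurableType => s _.
  exact: (measurable_state1 s (fun y => y = x s)).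
pose I01 : set R := `[0, 1[%classic.
have mI : measurable I01 by exact: measurable_itv.
have PI : P I01 = 1%E by rewrite [LHS](@uniform_prob_itv R 0 1) ?subr0.
have -> : P A = (P (A `\` I01) + P (A `&` I01))%E by exact: measureDI.
have -> : P (A `\` I01) = 0%E.
  apply/eqP; rewrite eq_le measure_ge0 andbT.
  have -> : 0%E = P (~` I01) by rewrite probability_setC// PI subee.
  by rewrite le_measure ?inE//; [exact: measurableD|exact: measurableC].
have -> : A `&` I01 = `[a, a + l[%classic.
  apply/seteqP; split => u /=; rewrite /I01 /= !in_itv /=.
    by move=> [Au u01]; apply: (h _ u01).1.1.
  move=> hu; have u01 : 0 <= u < 1.
    by move: hu => /andP[? ?]; apply/andP; split; lra.
  by split => //; apply: (h _ u01).1.2.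
rewrite add0e [LHS](@uniform_prob_itv R a (a + l)) ?lerDl//.
by congr (_%:E); lra.
Qed.

Lemma walk_exists : inhabited (walk c v0).
Proof.
constructor.
refine (@Walk R V c v0 _ _ P (fun t u => (state t u).1) _ _ _).
- by move=> t A; exact: measurable_state1.
- have [a [l h]] := path_interval_exists 0 (erefl v0 : (fun=> v0) 0%N = v0).
  rewrite (_ : _ @^-1` _ = setT) ?probability_setT//.
  by apply/seteqP; split.
move=> t x z past Ppast.
(* A past that is not null begins at [v0], because every trajectory does. *)
have x0 : x 0%N = v0.
  apply: contrapT => x0; move/eqP: Ppast; apply.
  rewrite (_ : past = set0) ?measure0//.
  by apply/seteqP; split => u //= /(_ 0%N isT) /= e; exact/x0/esym.
have [a [l h]] := path_interval_exists t x0.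
have Pl : P past = l%:E by exact: prob_path h.
have [a' h'] := path_interval_step z h.
have Plz := prob_path h'.
rewrite /cond_prob Pl (_ : _ `&` _ = [set u | forall s, (s <= t.+1)%N ->
    (state s u).1 = if (s <= t)%N then x s else z]); last first.
  apply/seteqP; split => u.
    move=> [uz up] s; rewrite leq_eqVlt => /predU1P[->|st].
      by rewrite ltnn.
    by rewrite -ltnS st; exact: up.
  move=> hu; split; first by have := hu t.+1 (leqnn _); rewrite ltnn.
  by move=> s st; rewrite /= hu ?st// leqW.
(* The conditional probability is a quotient of two interval lengths; [l] is nonzero because the
   past is not null. *)
rewrite Plz /= mulrC mulKf//.
by apply: contraNneq Ppast => l0; rewrite Pl l0.
Qed.

End WalkExistence.

(** * The network on the quadrant *)

Definition vertex : countType := (nat * nat)%type.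

Definition layer (x : vertex) : nat := (x.1 + x.2.*2)%N.

Section Quadrant.
Variables (R : realType) (lam : nat).
Hypothesis lam_gt1 : (1 < lam)%N.

(** A step to [k + 1] divides the weight by 512, a step to [(k - 1, j + 1)] multiplies it by 8, and
    the exponent is at least the layer. *)
Definition weight (x : vertex) : R := 8^-1 ^+ (3 * x.1 + 2 * x.2).

Section Conductances.
Variable F : nat -> R.

(* Edges to the next layer; [F l] is the relative conductance of those from
   [(k, j)] to [(k.+1, j)] that leave layer [l]. *)
Definition upward (x y : vertex) : R :=
  if (y.1 == x.1.+1) && (y.2 == x.2) then F (layer x) * weight x
  else if (x.1 == y.1.+1) && (y.2 == x.2.+1) then 8^-1 * weight x
  else 0.

(** At most one of the two [upward] terms is nonzero, as each edge that is not a loop climbs one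
    layer in one direction only. The factor [2 ^+ 15] lets the decrease of [height] ahead of the
    front, collected on the loop, outweigh the cost of all other edges. *)
Definition quadrant (x y : vertex) : R :=
  if x == y then 2 ^+ 15 * lam%:R ^+ layer x * weight x
  else upward x y + upward y x.

Definition neighbours (x : vertex) : seq vertex :=
  [:: x; (x.1.+1, x.2)] ++
  (if x.1 is k.+1 then [:: (k, x.2); (k, x.2.+1)] else [::]) ++
  (if x.2 is j.+1 then [:: (x.1.+1, j)] else [::]).

Lemma quadrant_sym x y : quadrant x y = quadrant y x.
Proof.
rewrite /quadrant eq_sym; case: eqP => [->//|_]; exact: addrC.
Qed.

Lemma weight_gt0 x : 0 < weight x.
Proof. by rewrite exprn_gt0// invr_gt0 ltr0n. Qed.

Lemma quadrant_loop x : quadrant x x = 2 ^+ 15 * lam%:R ^+ layer x * weight x.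
Proof. by rewrite /quadrant eqxx. Qed.

Let neqS n : (n == n.+1) = false. Proof. exact: ltn_eqF. Qed.
Let neqSl n : (n.+1 == n) = false. Proof. exact: gtn_eqF. Qed.
Let neqSS n : (n == n.+2) = false. Proof. exact: ltn_eqF. Qed.
Let neqSSl n : (n.+2 == n) = false. Proof. exact: gtn_eqF. Qed.

Lemma quadrant_right k j :
  quadrant (k, j) (k.+1, j) = F (layer (k, j)) * weight (k, j).
Proof.
rewrite /quadrant /upward /= xpair_eqE !(neqS, neqSl, neqSS, neqSSl, eqxx) /=.
by rewrite ?andbF addr0.
Qed.

Lemma weight_left k j : weight (k, j) = 512 * weight (k.+1, j).
Proof.
have -> : 512 = 8 ^+ 3 :> R by ring.
by rewrite /weight /= mulnS -addnA [in RHS]exprD mulrA -exprMn divff// expr1n mul1r.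
Qed.

Lemma weight_down k j : weight (k.+1, j) = 8^-1 * weight (k, j.+1).
Proof. by rewrite /weight /= -exprS; congr (_ ^+ _); lia. Qed.

Lemma quadrant_left k j : quadrant (k.+1, j) (k, j) =
  F (layer (k, j)) * (512 * weight (k.+1, j)).
Proof. by rewrite quadrant_sym quadrant_right weight_left. Qed.

Lemma quadrant_diag k j :
  quadrant (k.+1, j) (k, j.+1) = 8^-1 * weight (k.+1, j).
Proof.
rewrite /quadrant /upward /= xpair_eqE !(neqS, neqSl, neqSS, neqSSl, eqxx) /=.
by rewrite ?andbF addr0.
Qed.

Lemma quadrant_down k j : quadrant (k, j.+1) (k.+1, j) =
  8^-1 * (8^-1 * weight (k, j.+1)).
Proof. by rewrite quadrant_sym quadrant_diag weight_down. Qed.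

Lemma quadrant_out x y : y \notin neighbours x -> quadrant x y = 0.
Proof.
case: x y => [k j] [k' j']; rewrite /neighbours !mem_cat !inE !negb_or /=.
rewrite !xpair_eqE => /and3P[/andP[n1 n2] n3 n4].
rewrite /quadrant /upward /= xpair_eqE [k == k']eq_sym [j == j']eq_sym.
rewrite (negPf n1) (negPf n2).
case: ifPn => [/andP[/eqP ek /eqP ej]|_].
  by move: n3; rewrite ek ej !inE !xpair_eqE !eqxx orbT.
case: ifPn => [/andP[/eqP ek /eqP ej]|_].
  by move: n3; rewrite ek ej !inE !xpair_eqE !eqxx.
case: ifPn => [/andP[/eqP ek /eqP ej]|_].
  by move: n4; rewrite ek ej !inE !xpair_eqE !eqxx.
by rewrite addr0.
Qed.

Lemma neighbours_uniq x : uniq (neighbours x).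
Proof.
by case: x => -[|k] [|j]; rewrite /neighbours /= ?inE ?xpair_eqE
  ?(neqS, neqSl, neqSS, neqSSl, eqxx, andbF).
Qed.

(** All conductances are expressed through the weight of [x] itself, which then cancels from the
    drift inequality. The column [k = 0] is left out because the potential is at least 1 there. *)
Lemma sum_quadrant k j (f : vertex -> R) (x := (k.+1, j) : vertex) :
  \sum_(z <- neighbours x) quadrant x z * f z =
  weight x * (2 ^+ 15 * lam%:R ^+ layer x * f x + F (layer x) * f (k.+2, j) +
    512 * F (layer (k, j)) * f (k, j) + 8^-1 * f (k, j.+1) +
    (if j is j'.+1 then 64^-1 * f (k.+2, j') else 0)).
Proof.
rewrite /x /neighbours /= !big_cons quadrant_loop quadrant_right quadrant_left.
rewrite quadrant_diag; move: (2 ^+ 15 * _) => a.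
case: j => [|j] in x *; rewrite ?big_cons ?big_nil ?quadrant_down; last first.
  by rewrite (_ : 64^-1 = 8^-1 * 8^-1 :> R); [ring|field].
by ring.
Qed.

Hypothesis F_gt0 : forall l, 0 < F l.

Lemma upward_ge0 x y : 0 <= upward x y.
Proof.
rewrite /upward; case: ifP => _; first by rewrite mulr_ge0 ?ltW ?weight_gt0.
by case: ifP => _ //; rewrite mulr_ge0 ?invr_ge0 ?ltW ?weight_gt0.
Qed.

Lemma quadrant_ge0 x y : 0 <= quadrant x y.
Proof.
rewrite /quadrant; case: ifP => _; last by rewrite addr_ge0 ?upward_ge0.
by rewrite mulr_ge0 ?(ltW (weight_gt0 _))// mulr_ge0 ?exprn_ge0 ?ler0n.
Qed.

Lemma quadrant_network : network quadrant.
Proof. by split; [exact: quadrant_ge0|exact: quadrant_sym]. Qed.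

Lemma quadrant_locally_finite : locally_finite quadrant neighbours.
Proof.
split.
- exact: neighbours_uniq.
- exact: quadrant_ge0.
- exact: quadrant_out.
move=> x; rewrite /neighbours /= big_cons ltr_wpDr//.
  by apply: sumr_ge0 => z _; exact: quadrant_ge0.
rewrite quadrant_loop mulr_gt0 ?weight_gt0// mulr_gt0 ?exprn_gt0// ltr0n.
exact: ltnW.
Qed.

(** Paths run along a row to column 0, down that column to the corner, up again and out along the
    target row. Each step in column 0 makes a detour through column 1. *)
Lemma quadrant_connected : connected_network quadrant.
Proof.
pose conn (x y : vertex) :=
  exists2 p : seq vertex, path (fun u v => 0 < quadrant u v) x p & last x p = y.
have trans y x z : conn x y -> conn y z -> conn x z.
  move=> [p px py] [q qy qz]; exists (p ++ q); rewrite ?cat_path ?last_cat ?py//.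
  by rewrite px.
have edge x y : 0 < quadrant x y -> conn x y.
  by move=> xy; exists [:: y] => //=; rewrite xy.
have eighth_gt0 : 0 < 8^-1 :> R by rewrite invr_gt0 ltr0n.
have row_l k j : conn (k, j) (0%N, j).
  elim: k => [|k ih]; first by exists [::].
  apply: trans ih; apply: edge.
  by rewrite quadrant_left !mulr_gt0 ?weight_gt0 ?ltr0n.
have row_r k j : conn (0%N, j) (k, j).
  elim: k => [|k ih]; first by exists [::].
  apply: (trans _ _ _ ih); apply: edge.
  by rewrite quadrant_right !mulr_gt0 ?weight_gt0.
have col_d j : conn (0%N, j) (0%N, 0%N).
  elim: j => [|j ih]; first by exists [::].
  apply: (trans (1%N, j)); last exact: trans (row_l _ _) ih.
  apply: edge; rewrite quadrant_down; exact: mulr_gt0 (mulr_gt0 _ (weight_gt0 _)).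
have col_u j : conn (0%N, 0%N) (0%N, j).
  elim: j => [|j ih]; first by exists [::].
  apply: (trans _ _ _ ih); apply: (trans (1%N, j)) => //.
  apply: edge; rewrite quadrant_diag; exact: mulr_gt0 (weight_gt0 _).
move=> [k j] [k' j'].
apply: (trans (0%N, j)) => //; apply: (trans (0%N, 0%N)) => //.
by apply: (trans (0%N, j')).
Qed.

Hypothesis F_le1 : forall l, F l <= 1.

Lemma weight_le x : weight x <= 8^-1 ^+ layer x.
Proof.
apply: ler_wiXn2l; [by rewrite invr_ge0 ler0n|by rewrite invf_le1 ?ler1n|].
by rewrite /layer -mul2n; lia.
Qed.

(** Since edges never skip a layer, those that leave the set of layers up to [N] start in layer [N],
    where weights are smallest. *)
Lemma quadrant_up x y : y \in neighbours x -> (layer x < layer y)%N ->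
  layer y = (layer x).+1 /\ quadrant x y <= weight x.
Proof.
case: x => k j; have w0 := weight_gt0 (k, j).
rewrite /neighbours /= !inE => /or3P[/eqP->|/eqP->|].
- by rewrite ltnn.
- rewrite quadrant_right => _; split; first by rewrite /layer /= addSn.
  by rewrite ler_piMl// ltW.
case: k w0 => [|k] w0; case: j w0 => [|j] w0 //=; rewrite !inE.
- move=> /eqP ->; rewrite /layer /= => h; exfalso.
  by move: h; rewrite !doubleS; lia.
- move=> /orP[] /eqP ->; rewrite /layer /=; first by lia.
  move=> _; rewrite quadrant_diag; split; first by rewrite !doubleS; lia.
  by rewrite ler_piMl ?ltW//; lra.
- move=> /or3P[] /eqP ->; rewrite /layer /=; [by lia| |by lia].
  move=> _; rewrite quadrant_diag; split; first by rewrite !doubleS; lia.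
  by rewrite ler_piMl ?ltW//; lra.
Qed.

Lemma size_neighbours x : (size (neighbours x) <= 5)%N.
Proof. by case: x => -[|k] [|j]. Qed.

(** The layers up to [N] contain at most [4 ^ N] vertices, each with at most 5 edges leaving this
    set, of conductance at most [8^-1 ^+ N]. The total is at most [5 * 2^-1 ^+ N]. *)
Lemma quadrant_small_boundaries : small_boundaries quadrant neighbours.
Proof.
move=> o e e0.
have [N oN Ne] : exists2 N, (layer o <= N)%N & 5 * 2^-1 ^+ N <= e :> R.
  pose N := (layer o + (Num.truncn (5 / e)).+1)%N.
  exists N; first exact: leq_addr.
  rewrite exprVn ler_pdivrMr ?exprn_gt0// mulrC -ler_pdivrMr//.
  apply: (@le_trans _ _ N%:R).
    apply: (le_trans (ltW (truncnS_gt (5 / e)))).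
    by rewrite ler_nat leq_addl.
  by rewrite -natrX ler_nat ltnW// ltn_expl.
pose B := [seq x <- [seq (k, j) : vertex | k <- iota 0 N.+1, j <- iota 0 N.+1] |
  (layer x <= N)%N].
have sB : (size B <= 4 ^ N)%N.
  rewrite (leq_trans (size_subseq (filter_subseq _ _)))//.
  rewrite size_allpairs size_iota (_ : 4 = 2 * 2)%N// expnMn.
  by rewrite leq_mul// ltn_expl.
have inB x : (x \in B) = (layer x <= N)%N.
  rewrite mem_filter; apply: andb_idr; case: x => k j h.
  have {}h : (k + j.*2 <= N)%N by [].
  by apply: (allpairs_f (fun k j => (k, j) : vertex)); rewrite mem_iota; lia.
exists B; split.
- rewrite filter_uniq// allpairs_uniq ?iota_uniq//.
  by move=> [? ?] [? ?] _ _ [-> ->].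
- by rewrite inB.
apply: le_trans Ne.
apply: (@le_trans _ _ (\sum_(x <- B) 5 * 8^-1 ^+ N)).
  rewrite big_seq [leRHS]big_seq; apply: ler_sum => x; rewrite inB => xN.
  rewrite big_mkcond /=.
  apply: (@le_trans _ _ (\sum_(y <- neighbours x) 8^-1 ^+ N)).
    rewrite big_seq [leRHS]big_seq; apply: ler_sum => y yx.
    rewrite inB -ltnNge; case: ifP => [Ny|_]; last by rewrite exprn_ge0.
    have [ly le] := quadrant_up yx (leq_ltn_trans xN Ny).
    have <- : layer x = N by apply/eqP; rewrite eqn_leq xN -ltnS -ly.
    by rewrite (le_trans le)// weight_le.
  rewrite big_const_seq count_predT iter_addr_0 -[leLHS]mulr_natl.
  by rewrite ler_pM2r ?exprn_gt0// ler_nat size_neighbours.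
rewrite big_const_seq count_predT iter_addr_0 -[leLHS]mulr_natl.
rewrite mulrCA ler_pM2l//.
apply: (@le_trans _ _ ((4 ^ N)%:R * 8^-1 ^+ N)).
  by rewrite ler_pM2r ?exprn_gt0// ler_nat.
rewrite natrX -exprMn; apply: lerXn2r; rewrite ?nnegrE; lra.
Qed.
End Conductances.
End Quadrant.

(** * The moving front *)

Section Front.
Variables (R : realType) (lam : nat).
Hypothesis lam_big : 512 * 2 ^+ 15 <= lam%:R - 1 :> R.

(** Small enough for the edge to the left, despite its factor 512, to fall far below the diagonal
    one: [512 * dropped] is [2^-1 ^+ 9], against [8^-1]. *)
Definition dropped : R := 64^-1 ^+ 3.

(** The clock shows [t + 1], so it starts at [lam ^ 0] and the epochs from [lam ^ m] to [lam ^ m.+1]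
    cover all times. In epoch [m] exactly the layers below [m] have dropped. *)
Definition env (t l : nat) : R := if (t.+1 < lam ^ l.+1)%N then 1 else dropped.

(* For [T] between [lam ^ m] and [lam ^ m.+1]. Behind the front ([l <= m]) the
   factor quadruples in each epoch, slowly enough to be paid for by the drift
   towards smaller potentials; ahead of it, the factor decreases from [5 / 4] to
   [1], which pays for moves made before the front arrives. *)
Definition heightm (m l T : nat) : R :=
  if (l <= m)%N then
    4 ^+ (m - l) * (1 + 3 * (T%:R - lam%:R ^+ m) / (lam%:R ^+ m * (lam%:R - 1)))
  else 1 + (1 - T%:R / lam%:R ^+ l) / 4.

Definition height (l T : nat) : R := heightm (trunc_log lam T) l T.

Definition potential (t : nat) (x : vertex) : R :=
  2^-1 ^+ x.1 * height (layer x) t.+1.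

Let lam_gt1 : (1 < lam)%N.
Proof.
have : 1 <= 2 ^+ 15 :> R by apply: exprn_ege1; rewrite ler1n.
rewrite -(ltr_nat R); move: (2 ^+ 15) lam_big => p; lra.
Qed.

Let lamR : 1 < lam%:R :> R. Proof. by rewrite ltr1n. Qed.
Let lamX n : 0 < lam%:R ^+ n :> R.
Proof. exact/exprn_gt0/(lt_trans ltr01 lamR). Qed.

Let lam1_gt0 : 0 < lam%:R - 1 :> R. Proof. by rewrite subr_gt0. Qed.

Lemma env_gt0 t l : 0 < env t l.
Proof. by rewrite /env; case: ifP => _ //; rewrite exprn_gt0. Qed.

Lemma env_le1 t l : env t l <= 1.
Proof.
rewrite /env; case: ifP => _ //; rewrite /dropped exprn_ile1//; lra.
Qed.

(** The formulas of consecutive epochs agree at [lam ^ m.+1]: behind the front the linear factor has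
    grown to 4, and on the new front layer both formulas give 1. A step from [T] to [T + 1]
    therefore stays within one formula. *)
Lemma heightE m l T : (lam ^ m <= T <= lam ^ m.+1)%N ->
  height l T = heightm m l T.
Proof.
move=> /andP[mT]; rewrite leq_eqVlt => /predU1P[->|Tm]; last first.
  by rewrite /height (trunc_log_eq lam_gt1 (n := m)) ?mT.
rewrite /height trunc_expnK// /heightm natrX.
case: (ltngtP l m.+1) => lm.
- rewrite ltnS in lm; rewrite lm subSn// exprS subrr mulr0 mul0r addr0 mulr1.
  rewrite exprS.
  have -> : lam%:R * lam%:R ^+ m - lam%:R ^+ m = lam%:R ^+ m * (lam%:R - 1) :> R.
    by ring.
  rewrite mulfK; last by rewrite mulf_neq0 ?gt_eqF.
  by ring.
- by rewrite leqNgt (ltn_trans _ lm)//= .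
- rewrite lm ltnn subnn expr0 subrr mulr0 mul0r addr0 mulr1.
  by rewrite divff ?gt_eqF// subrr mul0r addr0.
Qed.


(** [D0] and [D1] are the heights of the front layer [m] at [T] and [T + 1]. Collected here is what
    the three drift estimates use: slow growth up to the front, and ahead of it a linear decrease
    whose rate is inverse to the holding time of the layer. *)
Lemma height_front m T : (lam ^ m <= T < lam ^ m.+1)%N ->
  exists D0 D1 : R, [/\ 1 <= D0 <= D1, D1 <= 4,
    D1 - D0 = 3 / (lam%:R ^+ m * (lam%:R - 1)) &
    [/\ forall i, (i <= m)%N -> height i T = 4 ^+ (m - i) * D0,
    forall i, (i <= m)%N -> height i T.+1 = 4 ^+ (m - i) * D1,
    forall i, (m < i)%N -> 1 <= height i T.+1 <= 5 / 4 &
    forall i, (m < i)%N -> height i T = height i T.+1 + (4 * lam%:R ^+ i)^-1]].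
Proof.
move=> /andP[mT Tm].
pose D S : R := 1 + 3 * (S%:R - lam%:R ^+ m) / (lam%:R ^+ m * (lam%:R - 1)).
have M0 := lamX m.
have N0 : 0 < lam%:R ^+ m * (lam%:R - 1) :> R by exact: mulr_gt0 M0 lam1_gt0.
have mTR : lam%:R ^+ m <= T%:R :> R by rewrite -natrX ler_nat.
have TmR : T%:R + 1 <= lam%:R ^+ m.+1 :> R by rewrite -natrX natr1 ler_nat.
have hT i : height i T = heightm m i T by rewrite (@heightE m)// mT ltnW.
have hT1 i : height i T.+1 = heightm m i T.+1.
  by rewrite (@heightE m)// Tm (leq_trans mT).
have Dd : D T.+1 - D T = 3 / (lam%:R ^+ m * (lam%:R - 1)).
  by rewrite /D -natr1; field; rewrite !gt_eqF.
have step0 : 0 <= 3 / (lam%:R ^+ m * (lam%:R - 1)) :> R.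
  by rewrite divr_ge0// ltW.
exists (D T), (D T.+1); split=> //.
- apply/andP; split; last by lra.
  rewrite lerDl; apply: divr_ge0; last exact: ltW.
  by rewrite mulr_ge0// subr_ge0.
- rewrite /D -lerBrDl ler_pdivrMr// -natr1; rewrite exprS in TmR; lra.
split=> i im.
- by rewrite hT /heightm im.
- by rewrite hT1 /heightm im.
- rewrite hT1 /heightm leqNgt im /=.
  have iX : lam%:R ^+ m.+1 <= lam%:R ^+ i :> R.
    by apply: ler_weXn2l => //; exact: ltW.
  have : 0 <= T.+1%:R / lam%:R ^+ i :> R by rewrite divr_ge0// ltW.
  have : T.+1%:R / lam%:R ^+ i <= 1 :> R.
    by rewrite ler_pdivrMr// mul1r -natr1; lra.
  move=> *; apply/andP; split; lra.
- rewrite hT hT1 /heightm leqNgt im /= -natr1; field.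
  by rewrite gt_eqF.
Qed.

Lemma height_ge1 l T : (0 < T)%N -> 1 <= height l T.
Proof.
move=> T0; have mT : (lam ^ trunc_log lam T <= T < lam ^ (trunc_log lam T).+1)%N.
  exact: trunc_log_bounds.
have [D0 [D1 [/andP[D01 _] _ _ [h0 _ h1 h2]]]] := height_front mT.
have [lm|lm] := leqP l (trunc_log lam T).
  rewrite h0// -[leLHS]mul1r ler_pM// exprn_ege1// ler1n//.
by rewrite h2// (le_trans (andP (h1 _ lm)).1)// lerDl invr_ge0 mulr_ge0// ltW.
Qed.

Let dropped_gt0 : 0 < dropped. Proof. by rewrite exprn_gt0. Qed.
Let dropped_small : 64 * (64 * dropped) = 1 / 64.
Proof. by rewrite /dropped exprS exprS expr1 !mulVKf// div1r. Qed.

(* The three cases of the one-step inequality at a vertex of layer [l] while the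
   front is at layer [m]: [l < m], [l = m] and [l > m]. *)
Let drift_behind (g D0 D1 c e : R) : 0 < g -> 1 <= D0 <= D1 ->
  c * (D1 - D0) <= 3 / 512 -> 1 <= c -> e = 0 \/ e = 1 ->
  c * (4 * g * D1) + dropped * (g * D1 / 2) + 1024 * dropped * (16 * g * D1) +
    g * D1 / 4 + e * (16 * g * D1 / 128) <=
  4 * g * D0 * (c + dropped + 512 * dropped + 1 / 8 + e / 64).
Proof.
move=> g0 /andP[D0_1 D1_le] cD c1 e01.
have D1_D0 : D1 <= D0 + 3 / 512.
  suff : D1 - D0 <= c * (D1 - D0) by lra.
  by rewrite ler_peMl// subr_ge0.
(* Linear arithmetic treats [dropped * D0] and [dropped * D1] as unknowns; these two facts control
   them. *)
have dD0 : 0 <= dropped * D0 by rewrite mulr_ge0 ?ltW//; lra.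
have dD1 : 64 * (64 * (dropped * D1)) = D1 / 64.
  by have := congr1 (fun x => x * D1) dropped_small; rewrite /=; lra.
set lhs := (X in X <= _); set rhs := (X in _ <= X).
have -> : lhs = g * (c * 4 * D1 + dropped * D1 / 2 +
    16 * (16 * (64 * (dropped * D1))) + D1 / 4 + e * D1 / 8).
  by rewrite /lhs; field.
have -> : rhs = g * (4 * c * D0 + 4 * (dropped * D0) +
    32 * (64 * (dropped * D0)) + D0 / 2 + e * D0 / 16).
  by rewrite /rhs; field.
(* Up to the factor [g], the diagonal edge gains about [D0 / 4]. The downward edge and the dropped
   left edge cost at most about [D0 / 16] each, and the loop at most [12 / 512]. *)
by rewrite ler_pM2l//; case: e01 => ->; lra.
Qed.

Let drift_at (A D0 D1 c e : R) : 1 <= D0 <= D1 -> 1 <= A <= 5 / 4 ->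
  c * (D1 - D0) <= 3 / 512 -> 1 <= c -> e = 0 \/ e = 1 ->
  c * D1 + A / 2 + 1024 * dropped * (4 * D1) + A / 4 + e * (4 * D1 / 128) <=
  D0 * (c + 1 + 512 * dropped + 8^-1 + e / 64).
Proof.
move=> /andP[D0_1 D1_le] /andP[A1 A2] cD c1 e01.
have D1_D0 : D1 <= D0 + 3 / 512.
  suff : D1 - D0 <= c * (D1 - D0) by lra.
  by rewrite ler_peMl// subr_ge0.
have dD0 : 0 <= dropped * D0 by rewrite mulr_ge0 ?ltW//; lra.
have dD1 : 64 * (64 * (dropped * D1)) = D1 / 64.
  by have := congr1 (fun x => x * D1) dropped_small; rewrite /=; lra.
(* The undropped edge to [k + 1] gains at least [3 / 8] and the diagonal one costs at most [3 / 16];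
   the left and downward edges cost small fractions of [D1]. *)
by case: e01 => ->; lra.
Qed.

Let drift_ahead (A Z W0 W1 c e : R) : 1 <= W1 -> 0 <= A <= 5 / 4 ->
  0 <= Z <= 4 -> c * (W0 - W1) = 2 ^+ 13 -> 0 <= c -> W1 <= W0 -> e = 0 \/ e = 1 ->
  c * W1 + A / 2 + 1024 * Z + A / 4 + e * (Z / 128) <=
  W0 * (c + 1 + 512 + 8^-1 + e / 64).
Proof.
move=> W1_1 /andP[A0 A1] /andP[Z0 Z1] cW c0 W10 e01.
have e13 : 2 ^+ 13 = 8 * 1024 :> R by ring.
rewrite e13 in cW.
(* The decrease of the height earns [2 ^+ 13], twice the [1024 * 4] that bounds the cost of the
   undropped left edge. *)
by case: e01 => ->; lra.
Qed.

Lemma potential_drift t x : potential t x < 1 ->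
  \sum_(z <- neighbours x) transition (quadrant lam (env t)) x z *
    potential t.+1 z <= potential t x.
Proof.
case: x => -[|k] j.
  (* In column 0 the potential is at least 1, contrary to the hypothesis. *)
  by rewrite /potential /= mul1r ltNge height_ge1.
move=> _; set x : vertex := (k.+1, j).
rewrite (sum_transition_mul (quadrant_locally_finite lam_gt1 (env_gt0 t))).
rewrite ler_pdivrMr; last first.
  exact: (lf_gt0 (quadrant_locally_finite lam_gt1 (env_gt0 t)) x).
(* As a sum against the constant 1, the total conductance is evaluated by [sum_quadrant] too. *)
rewrite (_ : \sum_(z <- _) quadrant _ _ x z =
  \sum_(z <- neighbours x) quadrant lam (env t) x z * 1); last first.
  by apply: eq_bigr => z _; rewrite mulr1.
rewrite !(sum_quadrant lam_gt1).
rewrite [leRHS]mulrCA ler_pM2l ?weight_gt0//.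
set l := layer (k, j).
have lx : layer x = l.+1 by rewrite /l /layer.
pose K : R := 2^-1 ^+ k.+1; have K0 : 0 < K by rewrite exprn_gt0.
(* The downward edge is missing in the row [j = 0]. *)
pose e : R := (0 < j)%:R.
pose c : R := 2 ^+ 15 * lam%:R ^+ l.+1.
pose W0 := height l.+1 t.+1; pose W1 := height l.+1 t.+2.
pose A := height l.+2 t.+2; pose Z := height l t.+2.
set FA := env t (layer x); set FZ := env t l.
have pK : potential t x = K * W0 by rewrite /potential lx.
have -> : potential t.+1 x = K * W1 by rewrite /potential lx.
have -> : potential t.+1 (k.+2, j) = K / 2 * A.
  by rewrite /potential /= exprSr; congr (_ * height _ _).
have -> : potential t.+1 (k, j) = 2 * K * Z.
  by rewrite /potential /K exprS mulrA divff// mul1r.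
have -> : potential t.+1 (k, j.+1) = 2 * K * A.
  rewrite /potential /K exprS mulrA divff// mul1r; congr (_ * height _ _).
  by rewrite /l /layer /= doubleS !addnS.
have -> : (if j is j'.+1 then 64^-1 * potential t.+1 (k.+2, j') else 0) =
    e * (64^-1 * (K / 2 * Z)).
  have pd j' : j = j'.+1 -> potential t.+1 (k.+2, j') = K / 2 * Z.
    move=> ej; rewrite /potential /= exprSr /Z /l ej; congr (_ * height _ _).
    by rewrite /layer /= doubleS !addnS !addSn.
  by rewrite /e; case ej: j => [|j']; rewrite ?mul0r// mul1r pd.
have -> : (if j is _.+1 then 64^-1 * 1 else 0) = e / 64 :> R.
  by rewrite /e; case: (j) => [|j']; rewrite ?mul0r// mul1r mulr1.
rewrite !mulr1 pK lx -/c.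
suff main : c * W1 + FA * (A / 2) + 1024 * FZ * Z + A / 4 + e * (Z / 128) <=
    W0 * (c + FA + 512 * FZ + 1 / 8 + e / 64).
  have := ler_wpM2l (ltW K0) main.
  set a := (X in X <= _ -> _); set b := (X in _ <= X -> _).
  set a' := (X in _ -> X <= _); set b' := (X in _ -> _ <= X).
  have -> : a = a' by rewrite /a /a'; field.
  by have -> : b = b' by rewrite /b /b'; field.
have e01 : e = 0 \/ e = 1 by rewrite /e; case: (j); [left|right].
have T0 : (0 < t.+1)%N by [].
have bnd := trunc_log_bounds lam_gt1 T0; move: bnd.
set m := trunc_log lam t.+1 => bnd.
have [D0 [D1 [D01 D14 dD [h0 h1 h2 h3]]]] := height_front bnd.
have envE i : env t i = if (m <= i)%N then 1 else dropped.
  rewrite /env; move: bnd => /andP[b1 b2]; have [mi|mi] := leqP m i.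
    by rewrite (leq_trans b2)// leq_exp2l.
  by rewrite ltnNge (leq_trans _ b1)// leq_exp2l.
have l0 := lamX l.+1.
have c1 : 1 <= c.
  rewrite /c -[leLHS]mulr1; apply: ler_pM => //; apply: exprn_ege1.
    by rewrite ler1n.
  exact: ltW.
(* A large [lam] keeps the height from growing noticeably while the loop holds a walk on or behind
   the front. *)
have cD : (l.+1 <= m)%N -> c * (D1 - D0) <= 3 / 512.
  move=> lm; rewrite dD /c.
  have lM : lam%:R ^+ l.+1 <= lam%:R ^+ m :> R.
    by apply: ler_weXn2l => //; exact: ltW.
  have p0 : 0 <= 2 ^+ 15 :> R by apply: exprn_ge0; rewrite ler0n.
  move: (2 ^+ 15) p0 lam_big => p p0 pL.
  rewrite mulrA ler_pdivrMr ?mulr_gt0//.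
  have : lam%:R ^+ l.+1 * (512 * p) <= lam%:R ^+ m * (lam%:R - 1).
    apply: ler_pM lM pL; first exact: ltW.
    by apply: mulr_ge0 p0; exact: ler0n.
  lra.
rewrite /FA /FZ !lx !envE.
have [lm|lm|lm] := ltngtP l.+1 m.
- rewrite /= (leqNgt m l) (ltn_trans _ lm)//=.
  pose g : R := 4 ^+ (m - l.+2); have g0 : 0 < g by rewrite exprn_gt0.
  have e4 : 4 ^+ (m - l.+1) = 4 * g :> R by rewrite /g -exprS subnSK.
  have e16 : 4 ^+ (m - l) = 16 * g :> R.
    by rewrite -(subnSK (ltnW lm)) exprS e4; ring.
  have -> : W0 = 4 * g * D0 by rewrite /W0 h0 ?e4// ltnW.
  have -> : W1 = 4 * g * D1 by rewrite /W1 h1 ?e4// ltnW.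
  have -> : A = g * D1 by rewrite /A h1.
  have -> : Z = 16 * g * D1 by rewrite /Z h1 ?e16// ltnW// ltnW.
  by apply: drift_behind => //; apply: cD; exact: ltnW.
- rewrite /= (_ : (m <= l)%N)//=.
  (* The layer below [x] may be the front itself, where the height can be as large as 4. *)
  have hZ : 1 <= Z <= 4.
    rewrite /Z; case: (leqP l m) => lm'.
      have -> : l = m by apply/eqP; rewrite eqn_leq lm' -ltnS lm.
      by rewrite h1// subnn mul1r D14 andbT; case/andP: D01 => ? ?; lra.
    by have /andP[-> ?] := h2 _ lm' => /=; lra.
  have /andP[A1 A2] : 1 <= A <= 5 / 4 by rewrite h2// ltnW.
  have /andP[Z1 Z2] := hZ.
  have /andP[W1_1 _] := h2 _ lm.
  have cW : c * (W0 - W1) = 2 ^+ 13.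
    rewrite /W0 h3// /W1 addrAC subrr add0r /c.
    rewrite (exprD 2 2 13); have : lam%:R ^+ l.+1 != 0 :> R by rewrite gt_eqF.
    by move=> ?; rewrite invfM expr2; field.
  rewrite !mul1r !mulr1; apply: drift_ahead => //.
  + by apply/andP; split; lra.
  + by apply/andP; split; lra.
  + by lra.
  + by rewrite /W0 h3// lerDl invr_ge0 mulr_ge0// ltW.
- rewrite /= (leqNgt m l) -lm ltnSn /= !mul1r.
  have -> : W0 = D0 by rewrite /W0 h0 ?lm// subnn mul1r.
  have -> : W1 = D1 by rewrite /W1 h1 ?lm// subnn mul1r.
  have -> : Z = 4 * D1 by rewrite /Z h1 -?lm// subSnn expr1.
  apply: drift_at => //; first by rewrite /A h2// lm.
  by apply: cD; rewrite lm.
Qed.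

Lemma potential_ge0 t x : 0 <= potential t x.
Proof.
by rewrite mulr_ge0 ?exprn_ge0// (le_trans _ (height_ge1 _ _)).
Qed.

(** Once the front is at least [x.1] layers beyond [x], the height is at least [4 ^+ x.1], which
    outweighs [2^-1 ^+ x.1]. *)
Lemma potential_eventually x : exists N, forall t, (N <= t)%N ->
  1 <= potential t x.
Proof.
exists (lam ^ (layer x + x.1))%N => t Nt.
have bnd := trunc_log_bounds lam_gt1 (ltn0Sn t); move: bnd.
set m := trunc_log lam t.+1 => bnd.
have [D0 [D1 [/andP[D01 _] _ _ [h0 _ _ _]]]] := height_front bnd.
have mx : (layer x + x.1 <= m)%N.
  rewrite -ltnS -(ltn_exp2l _ _ lam_gt1).
  by case/andP: bnd => _; apply: leq_ltn_trans; exact: leqW.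
rewrite /potential h0 ?(leq_trans _ mx) ?leq_addr//.
rewrite -[leLHS](@mulr1 R) mulrA; apply: ler_pM => //.
apply: (@le_trans _ _ (2^-1 ^+ x.1 * 4 ^+ x.1)).
  rewrite -exprMn exprn_ege1//; lra.
rewrite ler_pM2l ?exprn_gt0//; apply: ler_weXn2l; rewrite ?ler1n//.
by rewrite leq_subRL ?(leq_trans _ mx) ?leq_addr.
Qed.

(** The clock starts at 1, in epoch 0, where layer [k] is ahead of the front and has height at most
    [5 / 4 + 1 / 4]. *)
Lemma potential_start k : (0 < k)%N -> potential 0 (k, 0%N) <= 2 * 2^-1 ^+ k.
Proof.
move=> k0; have bnd : (lam ^ 0 <= 1 < lam ^ 1)%N by rewrite expn1 lam_gt1.
have [D0 [D1 [_ _ _ [_ _ h2 h3]]]] := height_front bnd.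
rewrite /potential mulrC ler_pM2r ?exprn_gt0// /layer /= addn0 h3//.
have /andP[_] := h2 _ k0.
have : (4 * lam%:R ^+ k)^-1 <= 4^-1 :> R.
  rewrite lef_pV2 ?posrE ?mulr_gt0// ler_peMr// exprn_ege1//; exact: ltW.
lra.
Qed.

End Front.

(** * Monotonicity, limit and recurrence of the environment *)

Section Environment.
Variables (R : realType) (lam : nat).
Hypothesis lam_gt1 : (1 < lam)%N.

(** Each conductance involves at most one value of [F], so an edge inherits its limit and its single
    change from one layer of [env]. *)
Lemma quadrant_key (x y : vertex) : exists l, forall F G : nat -> R,
  F l = G l -> quadrant lam F x y = quadrant lam G x y.
Proof.
have [xy|xy] := boolP (y.1 == x.1.+1).
  exists (layer x) => F G FG; rewrite /quadrant /upward FG (eqP xy).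
  by rewrite (_ : (x.1 == x.1.+2) = false)//; exact: ltn_eqF.
by exists (layer y) => F G FG; rewrite /quadrant /upward FG (negPf xy).
Qed.

Lemma quadrant_le (F G : nat -> R) (x y : vertex) : (forall l, F l <= G l) ->
  quadrant lam F x y <= quadrant lam G x y.
Proof.
move=> FG; rewrite /quadrant; case: ifP => // _.
by apply: lerD; rewrite /upward; case: ifP => // _; rewrite ler_pM2r// weight_gt0.
Qed.

Lemma quadrant_scale (a : R) (F G : nat -> R) (x y : vertex) : 0 <= a <= 1 ->
  (forall l, a * F l <= G l) -> a * quadrant lam F x y <= quadrant lam G x y.
Proof.
move=> /andP[a0 a1] FG; have w0 z : 0 <= weight R z by exact/ltW/weight_gt0.
have up u v : a * upward F u v <= upward G u v.
  rewrite /upward; case: ifP => _; first by rewrite mulrA ler_wpM2r.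
  by case: ifP => _; rewrite ?mulr0// ler_piMl// mulr_ge0// invr_ge0.
rewrite /quadrant; case: ifP => _; last by rewrite mulrDr lerD.
apply: ler_piMl => //; exact: mulr_ge0.
Qed.

Lemma env_le s t l : (s <= t)%N -> env R lam t l <= env R lam s l.
Proof.
move=> st; rewrite /env; have [|h] := ltnP t.+1.
  by move=> h; rewrite (leq_ltn_trans _ h).
by case: ifP => // _; rewrite exprn_ile1//; lra.
Qed.

Lemma env_eventually l t : (lam ^ l.+1 <= t)%N -> env R lam t l = dropped R.
Proof. by move=> h; rewrite /env ltnNge (leq_trans h). Qed.

Lemma env_changes l t :
  env R lam t.+1 l != env R lam t l -> t.+2 = (lam ^ l.+1)%N.
Proof.
rewrite /env; have [h1|h1] := ltnP t.+2; have [h2|h2] := ltnP t.+1 => //;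
  rewrite ?eqxx//.
- by move: (ltn_trans (ltnSn _) h1); rewrite ltnNge h2.
- by move=> _; apply/eqP; rewrite eqn_leq h1 h2.
Qed.

Lemma quadrant_decreases :
  decreases_to (fun t => quadrant lam (env R lam t))
    (quadrant lam (fun=> dropped R)).
Proof.
move=> x y; split.
  by move=> s t st; apply: quadrant_le => l; exact: env_le.
have [l hl] := quadrant_key x y.
apply: cvg_near_cst; exists (lam ^ l.+1)%N => // t /= lt.
by apply: hl; exact: env_eventually.
Qed.

Lemma quadrant_changes :
  changes_at_most_once (fun t => quadrant lam (env R lam t)).
Proof.
move=> x y s t; have [l hl] := quadrant_key x y.
have key u : quadrant lam (env R lam u.+1) x y != quadrant lam (env R lam u) x y ->
    u.+2 = (lam ^ l.+1)%N.
  by move=> h; apply: env_changes; apply: contraNneq h => /hl ->.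
by move=> /key hs /key ht; do 2 apply: succn_inj; rewrite hs ht.
Qed.

Lemma quadrant_recurrent (F : nat -> R) : (forall l, 0 < F l <= 1) ->
  recurrent_network (quadrant lam F).
Proof.
move=> F01 x.
have F0 l : 0 < F l by case/andP: (F01 l).
have F1 l : F l <= 1 by case/andP: (F01 l).
have lf := quadrant_locally_finite lam_gt1 F0.
split; first exact: (walk_exists x (fun=> lf)).
move=> X; apply: (walk_returns lf (quadrant_sym _ _) X).
exact: quadrant_small_boundaries.
Qed.

Lemma quadrant_irreducible (F : nat -> R) : (forall l, 0 < F l) ->
  network_walk_irreducible (quadrant lam F).
Proof.
move=> F0 x y; have lf := quadrant_locally_finite lam_gt1 F0.
split; first exact: (walk_exists x (fun=> lf)).
move=> X; have [p px py] := quadrant_connected lam_gt1 F0 x y.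
by exists (size p); rewrite -py; exact: (walk_reach (fun=> lf)).
Qed.

End Environment.

Theorem theorem1p10 (R : realType) :
  (forall delta : R, 0 < delta ->
     exists (V : countType) (c : nat -> V -> V -> R) (cinf : V -> V -> R)
            (v0 : V) (alpha : R),
       (forall t, network (c t)) /\ network cinf /\
       connected_network (c 0%N) /\
       (forall v, (total_conductance (c 0%N) v < +oo)%E) /\
       0 < alpha < 1 /\
       decreases_to c cinf /\
       (forall x y, alpha * c 0%N x y <= cinf x y) /\
       changes_at_most_once c /\
       (forall t, recurrent_network (c t)) /\ recurrent_network cinf /\
       for_walk (fun X : walk c v0 =>
         ((1 - delta)%:E <= walk_pr X (@finitely_often V))%E))
  /\
  ~ (forall (V : countType) (c : nat -> V -> V -> R) (cinf : V -> V -> R)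
            (alpha : R),
       (forall t, network (c t)) -> network cinf ->
       (forall v, (total_conductance (c 0%N) v < +oo)%E) ->
       0 < alpha ->
       decreases_to c cinf ->
       (forall x y, alpha * c 0%N x y <= cinf x y) ->
       network_walk_irreducible (c 0%N) ->
       recurrent_network (c 0%N) ->
       forall (v0 : V) (X : walk c v0),
         walk_pr X (@infinitely_often V) = 1%E).
Proof.
have [lam lam_gt1 lam_big] : exists2 lam, (1 < lam)%N &
    512 * 2 ^+ 15 <= lam%:R - 1 :> R.
  move: (512 * _) => x; exists (Num.truncn x).+2 => //.
  by rewrite -natr1 addrK; exact/ltW/truncnS_gt.
have d01 : 0 < dropped R < 1.
  by rewrite exprn_gt0//= exprn_ilt1//; lra.
have [d0 d1] : 0 < dropped R /\ dropped R < 1 by apply/andP.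
have e0 t l : 0 < env R lam t l by exact: env_gt0.
have e1 t l : env R lam t l <= 1 by exact: env_le1.
pose c t : vertex -> vertex -> R := quadrant lam (env R lam t).
pose cinf : vertex -> vertex -> R := quadrant lam (fun=> dropped R).
have lf t : locally_finite (c t) neighbours.
  exact: quadrant_locally_finite.
have fin v : (total_conductance (c 0%N) v < +oo)%E.
  by rewrite (total_conductanceE (lf 0%N)) ltry.
have scale x y : dropped R * c 0%N x y <= cinf x y.
  apply: quadrant_scale; first by rewrite !ltW.
  by move=> l; rewrite ler_piMr// ltW.
have rec t : recurrent_network (c t).
  by apply: quadrant_recurrent => // l; rewrite e0 e1.
have trans delta : 0 < delta -> exists v0 : vertex, forall X : walk c v0,
    ((1 - delta)%:E <= walk_pr X (@finitely_often vertex))%E.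
  (* Since [2 / delta < k < 2 ^ k], the bound [2 * 2^-1 ^+ k] on the initial potential is at most
     [delta]. *)
  move=> delta0; pose k := (Num.truncn (2 / delta)).+1.
  exists (k, 0%N) => X.
  have := @walk_finitely_often _ _ c _ _ lf X (potential R lam).
  move=> /(_ (potential_ge0 lam_big) (potential_drift lam_big)
    (potential_eventually lam_big)).
  apply: le_trans; rewrite lee_fin.
  rewrite lerD2l lerN2.
  apply: le_trans (potential_start lam_big (ltn0Sn _)) _.
  rewrite exprVn ler_pdivrMr ?exprn_gt0// mulrC -ler_pdivrMr//.
  apply: (@le_trans _ _ k%:R); first exact/ltW/truncnS_gt.
  by rewrite -natrX ler_nat ltnW// ltn_expl.
split=> [delta delta0|].
  have [v0 Xv0] := trans _ delta0.
  exists vertex, c, cinf, v0, (dropped R).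
  split; first by move=> t; exact: quadrant_network.
  split; first exact: quadrant_network.
  split; first exact: quadrant_connected.
  split; first exact: fin.
  split; first exact: d01.
  split; first exact: quadrant_decreases.
  split; first exact: scale.
  split; first exact: quadrant_changes.
  split; first exact: rec.
  split; first by apply: quadrant_recurrent => // l; rewrite d0 ltW.
  by split; first exact: walk_exists lf.
move=> H.
(* Any [delta] below 1 would do: finitely many visits with positive probability exclude infinitely
   many visits almost surely. *)
have [|v0 Xv0] := trans 2^-1; first by rewrite invr_gt0.
have [X] := walk_exists v0 lf.
apply: (@walk_not_infinitely_often _ _ _ _ X).
  by apply: lt_le_trans (Xv0 X); rewrite lte_fin; lra.
apply: (H vertex c cinf (dropped R)) => //.
- by move=> t; exact: quadrant_network.
- exact: quadrant_network.
- exact: quadrant_decreases.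
- exact: quadrant_irreducible.
Qed.
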